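(* Let $p \geq 2$ be an integer and let $q, r$ be integers coprime to $p$ (i.e. representing elements of $(\mathbb{Z}/p\mathbb{Z})^\times$). Then: (I) $\widehat{G_{p,q}} \cong \widehat{G_{p,r}}$; (II) $G_{p,q} \cong F_{2p} \rtimes \mathbb{Z}$ for some action of $\mathbb{Z}$ on $F_{2p}$; in particular $G_{p,q}$ is free-by-cyclic; (III) $G_{p,q} \cong G_{p,r}$ if and only if $q \equiv \pm r \pmod{p}$.
   Context: For integers $p \geq 2$ and $q \in \mathbb{Z}$, let $$A_{p,q} = \langle a,b,c,h \mid [h,a]=[h,b]=[h,c]=1,\ a^p h^{q}=1,\ b^p h^{-q}=1 \rangle.$$ The elements $c$ and $abc$ have infinite order in $A_{p,q}$, and $G_{p,q}$ is the HNN extension of $A_{p,q}$ with stable letter $s$ and associated subgroups $\langle c\rangle$ and $\langle abc\rangle$: $$G_{p,q} = \langle A_{p,q}, s \mid s^{-1} c s = abc\rangle.$$ $F_n$ denotes the free group of rank $n$. A group is called free-by-cyclic if it is isomorphic to $F_n \rtimes \mathbb{Z}$ for some finitely generated free group $F_n$ and some action of $\mathbb{Z}$ on $F_n$. $\widehat{G}$ denotes the profinite completion of $G$, i.e. the inverse limit of the inverse system of finite quotients of $G$. *)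

(* Defs.v *)
From HB Require Import structures.
From mathcomp Require Import all_boot all_order all_algebra.
From mathcomp Require Import boolp classical_sets functions cardinality.
From mathcomp Require Import topology function_spaces.

Set Implicit Arguments.
Unset Strict Implicit.
Unset Printing Implicit Defensive.

Import Order.TTheory GRing.Theory Num.Theory.

Local Open Scope classical_set_scope.
Local Open Scope group_scope.

(* Possibly infinite groups are MathComp's [groupType]s. *)

Definition group_iso (G H : groupType) : Prop :=
  exists2 f : G -> H, bijective f & {morph f : x y / x * y}.

Definition expgz (G : groupType) (x : G) (n : int) : G :=
  match n with Posz k => x ^+ k | Negz k => x ^- k.+1 end.

Section FreeGroup.
Variable X : choiceType.

(* [(x, false)] stands for the generator x and [(x, true)] for its inverse. *)
Local Notation letter := (X * bool)%type.

Definition linv (l : letter) : letter := (l.1, ~~ l.2).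

Fixpoint reduced (w : seq letter) : bool :=
  if w is l :: w' then
    (if w' is l' :: _ then l' != linv l else true) && reduced w'
  else true.

Record free_group := Free { word :> seq letter; word_reduced : reduced word }.
HB.instance Definition _ := [isSub for word].
HB.instance Definition _ := [Choice of free_group by <:].

(* [l * w] in reduced form, when [w] is reduced *)
Definition lmul (l : letter) (w : seq letter) : seq letter :=
  if w is l' :: w' then (if l' == linv l then w' else l :: w) else [:: l].

Definition wmul (u v : seq letter) : seq letter := foldr lmul v u.

Lemma linvK : involutive linv.
Proof. by case=> x b; rewrite /linv /= negbK. Qed.

Lemma reduced_lmul l w : reduced w -> reduced (lmul l w).
Proof.
case: w => [//|l' w] /= /andP[h1 h2]; case: ifP => [//|/negbT h].
by rewrite /= h h1.
Qed.

Lemma lmulK l w : reduced w -> lmul (linv l) (lmul l w) = w.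
Proof.
case: w => [_|l' w] /=; first by rewrite linvK eqxx.
case: eqP => [-> | _] /=; last by rewrite linvK eqxx.
by case: w => [//|l2 w] /= /andP[/negbTE ->].
Qed.

Lemma reduced_wmul u v : reduced v -> reduced (wmul u v).
Proof. by move=> rv; elim: u => //= l u; apply: reduced_lmul. Qed.

Lemma wmul_lmul l v w : reduced w -> wmul (lmul l v) w = lmul l (wmul v w).
Proof.
move=> rw; case: v => [//|l' v] /=; case: eqP => [->|//].
by rewrite /= -[X in lmul X (lmul _ _)]linvK lmulK ?reduced_wmul.
Qed.

Lemma wmulA u v w : reduced w -> wmul u (wmul v w) = wmul (wmul u v) w.
Proof. by move=> rw; elim: u => //= l u ->; rewrite wmul_lmul. Qed.

Lemma wmulw0 w : reduced w -> wmul w [::] = w.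
Proof.
elim: w => //= l w IHw /andP[h rw]; rewrite IHw //.
by case: w h {rw IHw} => //= l' w /negbTE ->.
Qed.

Definition winv (w : seq letter) : seq letter := rev (map linv w).

Lemma wmul_cat u v w : wmul (u ++ v) w = wmul u (wmul v w).
Proof. exact: foldr_cat. Qed.

Lemma wmul_winv_l w v : reduced v -> wmul (winv w) (wmul w v) = v.
Proof.
move=> rv; elim: w => //= l w IHw; rewrite /winv /= rev_cons -cats1 wmul_cat.
by rewrite /= lmulK ?reduced_wmul.
Qed.

Lemma reduced_winv w : reduced w -> reduced (winv w).
Proof.
have reducedE (s : seq letter) :
  reduced s = sorted (fun l l' => l' != linv l) s.
  by elim: s => //= l [//|l' s] ->.
rewrite !reducedE /winv rev_sorted sorted_map; apply: sub_sorted => l l' /=.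
by apply: contra => /eqP ->; rewrite !linvK.
Qed.

Definition free_one : free_group := @Free [::] isT.
Definition free_mul (u v : free_group) : free_group :=
  Free (reduced_wmul u (word_reduced v)).
Definition free_inv (u : free_group) : free_group :=
  Free (reduced_winv (word_reduced u)).

Fact free_mulA : associative free_mul.
Proof. by move=> u v w; apply/val_inj/wmulA/word_reduced. Qed.
Fact free_mul1 : left_id free_one free_mul.
Proof. by move=> u; apply/val_inj. Qed.
Fact free_mulr1 : right_id free_one free_mul.
Proof. by move=> u; apply/val_inj/wmulw0/word_reduced. Qed.
Fact free_mulV : left_inverse free_one free_inv free_mul.
Proof.
move=> u; apply/val_inj; rewrite /= -[X in wmul _ X](wmulw0 (word_reduced u)).
exact: wmul_winv_l.
Qed.
Fact free_mulrV : right_inverse free_one free_inv free_mul.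
Proof.
move=> u; have := congr1 val (free_mulV (free_inv u)) => /= h.
apply/val_inj => /=; rewrite -[RHS]h; congr wmul.
by rewrite /winv map_rev revK mapK //; apply: linvK.
Qed.

HB.instance Definition _ :=
  isGroup.Build free_group free_mulA free_mul1 free_mulr1 free_mulV free_mulrV.

Definition fgen (x : X) : free_group := @Free [:: (x, false)] isT.

(* the homomorphism extending f *)
Definition free_ext (G : groupType) (f : X -> G) (w : free_group) : G :=
  \prod_(l <- word w) (if l.2 then (f l.1)^-1 else f l.1).

End FreeGroup.

Record normal_subgroup (G : groupType) := NormalSubgroup {
  nsub :> set G;
  nsub1 : nsub 1;
  nsubM : forall x y, nsub x -> nsub y -> nsub (x * y);
  nsubV : forall x, nsub x -> nsub x^-1;
  nsubJ : forall x y, nsub x -> nsub (x ^ y) }.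

Section QuotientGroup.
Variables (G : groupType) (N : normal_subgroup G).

Definition coset_eq (x y : G) : bool := `[< nsub N (x^-1 * y) >].

Fact coset_eq_refl : reflexive coset_eq.
Proof. by move=> x; apply/asboolP; rewrite mulVg; apply: nsub1. Qed.
Fact coset_eq_sym : symmetric coset_eq.
Proof.
move=> x y; apply/asboolP/asboolP => /nsubV; by rewrite invgM invgK.
Qed.
Fact coset_eq_trans : transitive coset_eq.
Proof.
move=> y x z /asboolP h1 /asboolP h2; apply/asboolP.
by have := nsubM h1 h2; rewrite -mulgA mulVKg.
Qed.

Canonical coset_equiv :=
  EquivRel coset_eq coset_eq_refl coset_eq_sym coset_eq_trans.

Local Open Scope quotient_scope.

Definition quot : Type := {eq_quot coset_equiv}.
HB.instance Definition _ := Choice.on quot.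
HB.instance Definition _ := EqQuotient.on quot.

Definition qproj (x : G) : quot := \pi_quot x.

Lemma qprojP x y : qproj x = qproj y <-> nsub N (x^-1 * y).
Proof.
split=> [/eqP|h]; first by rewrite piE => /asboolP.
by apply/eqP; rewrite piE; apply/asboolP.
Qed.

Lemma qprojK (u : quot) : qproj (repr u) = u.
Proof. exact: reprK. Qed.

Definition quot_one : quot := qproj 1.
Definition quot_mul (u v : quot) : quot := qproj (repr u * repr v).
Definition quot_inv (u : quot) : quot := qproj (repr u)^-1.

Lemma qprojM x y : quot_mul (qproj x) (qproj y) = qproj (x * y).
Proof.
rewrite /quot_mul; apply/qprojP.
have /qprojP hx := qprojK (qproj x); have /qprojP hy := qprojK (qproj y).
move: (repr _) (repr _) hx hy => x' y' hx hy.
by have := nsubM hy (nsubJ y hx); rewrite /conjg invgM -!mulgA mulVKg.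
Qed.

Lemma qprojV x : quot_inv (qproj x) = qproj x^-1.
Proof.
rewrite /quot_inv; apply/qprojP.
have /qprojP := qprojK (qproj x); move: (repr _) => x' /nsubV /nsubJ.
by move=> /(_ x^-1); rewrite /conjg !invgM !invgK -!mulgA mulVKg.
Qed.

Fact quot_mulA : associative quot_mul.
Proof.
move=> u v w; rewrite -(qprojK u) -(qprojK v) -(qprojK w).
by rewrite !qprojM mulgA.
Qed.
Fact quot_mul1 : left_id quot_one quot_mul.
Proof. by move=> u; rewrite -(qprojK u) qprojM mul1g. Qed.
Fact quot_mulr1 : right_id quot_one quot_mul.
Proof. by move=> u; rewrite -(qprojK u) qprojM mulg1. Qed.
Fact quot_mulV : left_inverse quot_one quot_inv quot_mul.
Proof. by move=> u; rewrite -(qprojK u) qprojV qprojM mulVg. Qed.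
Fact quot_mulrV : right_inverse quot_one quot_inv quot_mul.
Proof. by move=> u; rewrite -(qprojK u) qprojV qprojM mulgV. Qed.

HB.instance Definition _ :=
  isGroup.Build quot quot_mulA quot_mul1 quot_mulr1 quot_mulV quot_mulrV.

End QuotientGroup.

Section NormalClosure.
Variables (G : groupType) (R : set G).

Definition nclosure_set : set G :=
  [set x | forall N : normal_subgroup G, R `<=` N -> nsub N x].

Fact nclosure1 : nclosure_set 1.
Proof. by move=> N _; apply: nsub1. Qed.
Fact nclosureM x y : nclosure_set x -> nclosure_set y -> nclosure_set (x * y).
Proof. by move=> hx hy N RN; apply: nsubM; [apply: hx|apply: hy]. Qed.
Fact nclosureV x : nclosure_set x -> nclosure_set x^-1.
Proof. by move=> hx N RN; apply/nsubV/hx. Qed.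
Fact nclosureJ x y : nclosure_set x -> nclosure_set (x ^ y).
Proof. by move=> hx N RN; apply/nsubJ/hx. Qed.

Definition nclosure : normal_subgroup G :=
  NormalSubgroup nclosure1 nclosureM nclosureV nclosureJ.

End NormalClosure.

Record presentation := Presentation {
  pgens : choiceType;
  prels : set (free_group pgens) }.

Definition presented (P : presentation) : groupType :=
  quot (nclosure (@prels P)).

(* < P, s | s^-1 u s = v >; the stable letter s is the generator [None]. When
   u and v have the same order in the group A presented by P, this presents
   the HNN extension of A with associated subgroups <u> and <v>. *)
Definition hnn (P : presentation) (u v : free_group (pgens P)) : presentation :=
  let lift : free_group (pgens P) -> free_group (option (pgens P)) :=
    free_ext (fun x => fgen (Some x)) in
  let s := fgen (None : option (pgens P)) in
  Presentation
    ((lift @` @prels P) `|` [set s^-1 * lift u * s * (lift v)^-1]).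

Inductive abch := gen_a | gen_b | gen_c | gen_h.

Definition abch_ord (x : abch) : 'I_4 :=
  match x with
  | gen_a => inord 0 | gen_b => inord 1 | gen_c => inord 2 | gen_h => inord 3
  end.
Definition ord_abch (i : 'I_4) : abch :=
  match val i with 0 => gen_a | 1 => gen_b | 2 => gen_c | _ => gen_h end.
Fact abch_ordK : cancel abch_ord ord_abch.
Proof. by case; rewrite /ord_abch /= inordK. Qed.
HB.instance Definition _ := Countable.copy abch (can_type abch_ordK).

Definition A_pres (p : nat) (q : int) : presentation :=
  let a := fgen gen_a in let b := fgen gen_b in
  let c := fgen gen_c in let h := fgen gen_h in
  Presentation [set w | [\/ w = [~ h, a], w = [~ h, b] | w = [~ h, c]]
                     \/ w = a ^+ p * expgz h q \/ w = b ^+ p * expgz h (- q)%R].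

Definition G_ (p : nat) (q : int) : groupType :=
  presented (@hnn (A_pres p q) (fgen gen_c)
                  (fgen gen_a * fgen gen_b * fgen gen_c)).

Definition F_ (n : nat) : groupType := free_group 'I_n.

Record zaction (N : groupType) := ZAction {
  zact :> int -> N -> N;
  zact0 : forall x, zact 0%R x = x;
  zactD : forall i j x, zact (i + j)%R x = zact i (zact j x);
  zactM : forall i x y, zact i (x * y) = zact i x * zact i y }.

(* The unused argument carries the action, on which the group law depends. *)
Definition sdprodZ (N : groupType) (phi : zaction N) : Type := N * int.

Section SemidirectProduct.
Variables (N : groupType) (phi : zaction N).

HB.instance Definition _ := Choice.copy (sdprodZ phi) (N * int)%type.

Definition sdprodZ_one : sdprodZ phi := (1, 0%R).
Definition sdprodZ_mul (x y : sdprodZ phi) : sdprodZ phi :=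
  (x.1 * phi x.2 y.1, (x.2 + y.2)%R).
Definition sdprodZ_inv (x : sdprodZ phi) : sdprodZ phi :=
  (phi (- x.2)%R x.1^-1, (- x.2)%R).

Lemma zact1 i : phi i 1 = 1.
Proof. by apply: (mulgI (phi i 1)); rewrite -zactM !mulg1. Qed.

Fact sdprodZ_mulA : associative sdprodZ_mul.
Proof.
by move=> x y z; rewrite /sdprodZ_mul /= addrA zactM zactD mulgA.
Qed.
Fact sdprodZ_mul1 : left_id sdprodZ_one sdprodZ_mul.
Proof. by case=> x i; rewrite /sdprodZ_mul /= mul1g add0r zact0. Qed.
Fact sdprodZ_mulr1 : right_id sdprodZ_one sdprodZ_mul.
Proof. by case=> x i; rewrite /sdprodZ_mul /= zact1 mulg1 addr0. Qed.
Fact sdprodZ_mulV : left_inverse sdprodZ_one sdprodZ_inv sdprodZ_mul.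
Proof.
by case=> x i; rewrite /sdprodZ_mul /= -zactM mulVg zact1 addNr.
Qed.
Fact sdprodZ_mulrV : right_inverse sdprodZ_one sdprodZ_inv sdprodZ_mul.
Proof.
by case=> x i; rewrite /sdprodZ_mul /= -zactD addrN zact0 mulgV.
Qed.

HB.instance Definition _ := isGroup.Build (sdprodZ phi)
  sdprodZ_mulA sdprodZ_mul1 sdprodZ_mulr1 sdprodZ_mulV sdprodZ_mulrV.

End SemidirectProduct.

Definition free_by_cyclic (G : groupType) : Prop :=
  exists (n : nat) (phi : zaction (F_ n)), group_iso G (sdprodZ phi).

Record fin_normal (G : groupType) := FinNormal {
  fnsub :> normal_subgroup G;
  fnsub_finite : finite_set [set: quot fnsub] }.

Section ProfiniteCompletion.
Variable G : groupType.

Definition prod_finquot : topologicalType :=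
  prod_topology (fun N : fin_normal G => discrete_topology (quot N)).

(* Compatibility with the projections G / M -> G / N, stated on
   representatives of [x M]. *)
Definition compatible : set prod_finquot :=
  [set x | forall M N : fin_normal G, M `<=` N ->
             forall g : G, x M = qproj M g -> x N = qproj N g].

Definition profinite : Type := set_type compatible.
HB.instance Definition _ := Topological.on profinite.

Definition pcoord (x : profinite) (N : fin_normal G) : quot N := \val x N.

Lemma qproj_surj (N : normal_subgroup G) (u : quot N) :
  exists g, u = qproj N g.
Proof. by exists (repr u); rewrite qprojK. Qed.

Lemma pcoordP (x : profinite) : compatible (pcoord x).
Proof. exact: set_valP. Qed.

Lemma pcoord_inj (x y : profinite) : pcoord x = pcoord y -> x = y.
Proof. by move=> xy; apply: (@val_inj _ _ (set_type compatible)). Qed.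

Fact compatible1 : compatible (fun N => 1 : quot N).
Proof. by move=> M N MN g /qprojP h; apply/qprojP/MN. Qed.
Fact compatibleM (x y : profinite) :
  compatible (fun N => pcoord x N * pcoord y N).
Proof.
move=> M N MN g.
have [u Eu] := qproj_surj (pcoord x M).
have [v Ev] := qproj_surj (pcoord y M).
rewrite (pcoordP MN Eu) (pcoordP MN Ev) Eu Ev => h.
apply: etrans (qprojM _ _ _) _; apply/qprojP/MN/qprojP.
by rewrite -qprojM.
Qed.
Fact compatibleV (x : profinite) : compatible (fun N => (pcoord x N)^-1).
Proof.
move=> M N MN g.
have [u Eu] := qproj_surj (pcoord x M).
rewrite (pcoordP MN Eu) Eu => h.
apply: etrans (qprojV _ _) _; apply/qprojP/MN/qprojP.
by rewrite -qprojV.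
Qed.

Definition profinite_one : profinite := SigSub (mem_set compatible1).
Definition profinite_mul (x y : profinite) : profinite :=
  SigSub (mem_set (@compatibleM x y)).
Definition profinite_inv (x : profinite) : profinite :=
  SigSub (mem_set (@compatibleV x)).

Fact profinite_mulA : associative profinite_mul.
Proof.
move=> x y z; apply/pcoord_inj/functional_extensionality_dep=> N.
exact: mulgA.
Qed.
Fact profinite_mul1 : left_id profinite_one profinite_mul.
Proof.
by move=> x; apply/pcoord_inj/functional_extensionality_dep=> N; apply: mul1g.
Qed.
Fact profinite_mulr1 : right_id profinite_one profinite_mul.
Proof.
by move=> x; apply/pcoord_inj/functional_extensionality_dep=> N; apply: mulg1.
Qed.
Fact profinite_mulV : left_inverse profinite_one profinite_inv profinite_mul.
Proof.
by move=> x; apply/pcoord_inj/functional_extensionality_dep=> N; apply: mulVg.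
Qed.
Fact profinite_mulrV : right_inverse profinite_one profinite_inv profinite_mul.
Proof.
by move=> x; apply/pcoord_inj/functional_extensionality_dep=> N; apply: mulgV.
Qed.

HB.instance Definition _ := isGroup.Build profinite
  profinite_mulA profinite_mul1 profinite_mulr1 profinite_mulV profinite_mulrV.

End ProfiniteCompletion.

(* isomorphism of topological groups between the completions of G and H *)
Definition profinite_iso (G H : groupType) : Prop :=
  exists (f : profinite G -> profinite H) (g : profinite H -> profinite G),
    [/\ cancel f g, cancel g f, {morph f : x y / x * y},
        continuous f & continuous g].

(* Main.v *)
From HB Require Import structures.
Require Import Defs.
From mathcomp Require Import all_boot all_order all_algebra.
From mathcomp Require Import algC cyclotomic ring zify.
From mathcomp Require Import boolp classical_sets functions cardinality.
From mathcomp Require Import topology.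

Set Implicit Arguments.
Unset Strict Implicit.
Unset Printing Implicit Defensive.

Import Order.TTheory GRing.Theory Num.Theory.

Local Open Scope group_scope.

(** Let [k] be the residue of [- q] modulo [p].  As [q] is prime to [p], the
abelian group generated by [a] and [h] is infinite cyclic: with
[u p + v q = 1], the element [al = a^-v h^u] satisfies [al^p = h] and
[al^-q = a].  In the same way [h = be^p] and [b = be^q].  Hence [G_{p,q}] is
generated by [al], [be], [c], [s] subject to
[al^p = be^p], [c al^p = al^p c] and [c s = s al^k be^-k c],
and [q] matters only through [k].  A [marking] of a group is such a presentation
([G_marking]); everything below is about marked groups.

Replacing [al], [be] by [al^K], [be^K] turns the relations for [k'] into
those for [k] as soon as [K k = k'] modulo [p] ([relations_scale]).  With
[K = -1] this is the isomorphism for [r = - q] ([marking_inv]).  For the profinite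
completions, choose a unit [K] of the profinite integers with [K k = k'] modulo [p]
([exists_profinite_unit]): powers with exponent [K] make sense in every finite
quotient, and [al |-> al^K], [be |-> be^K] is an isomorphism of profinite
completions ([marking_profinite_iso]).

The group fibres over the integers by [al], [be], [c] |-> 1 and [s] |-> 0.  The kernel
is free on the elements [al^i c^-i] for [1 <= i <= p], [be^i c^-i] for [1 <= i < p]
and [s], on which conjugation by [c] is explicit ([marking_fibration]).

Conversely, let [f] be an isomorphism between groups marked with [k] and [k'], and put [x = f al], [y = f be], so that [x^p = y^p].
- Homomorphisms to groups of affine maps of the complex line determine [f] on the
  abelianization up to signs: an affine map that is not a translation has a unique
  fixed point, so that images with too many commutation relations are abelian
  ([exp_iso_units], [exp_iso_al_cc]).
- Map the target to a wreath product with the integers, [s] being the translation.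
  The integral degree of [x] is then a Laurent polynomial; a nonzero complex root
  of it would make some nonabelian affine image abelian, so it is a monomial of
  coefficient 1 or -1 ([degree_image_al]): outside of one coordinate [x] and [y]
  have degree 0.
- In each coordinate use the matrices [rotA] and [rotB] of order [p], which depend
  on a parameter [T], and which are simultaneously triangular at [T = 0] and at
  [T = 1], in opposite ways.  A matrix of finite order has a constant trace;
  comparing the traces at the two ends shows that, unless [x] and [y] have the same
  first diagonal entry at [T = 1], both entries are 1 or the determinant
  ([bitri_roots]).
- The relation [c s = s al^k be^-k c] says that the sequence of these entries for
  [f c] jumps once, by a factor [z^k], [z^-k] or 1 with [z] a primitive [p]-th root
  of unity, whereas its two ends are 1 and [z^k'] or [z^-k'] ([single_jump],
  [chi_ends]).  Hence [k = k'] or [k = - k'] modulo [p] ([marking_rigid]). *)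

(** * Homomorphisms, powers and presentations *)
Section Homs.
Variables (G H : groupType) (f : G -> H) (fM : {morph f : x y / x * y}).

Lemma hom1 : f 1 = 1.
Proof. by apply: (mulgI (f 1)); rewrite -fM !mulg1. Qed.

Lemma homV x : f x^-1 = (f x)^-1.
Proof. by apply: (mulgI (f x)); rewrite -fM !mulgV hom1. Qed.

Lemma homX x n : f (x ^+ n) = f x ^+ n.
Proof. by elim: n => [|n IHn]; rewrite ?expg0 ?hom1 // !expgS fM IHn. Qed.

End Homs.

Lemma hom_comp (G H K : groupType) (f : G -> H) (g : H -> K) :
  {morph f : x y / x * y} -> {morph g : x y / x * y} ->
  {morph g \o f : x y / x * y}.
Proof. by move=> fM gM x y /=; rewrite fM gM. Qed.

Section IntPowers.
Variable G : groupType.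
Implicit Types (x y : G) (i j : int).

Lemma expgzS x i : expgz x (i + 1)%R = expgz x i * x.
Proof.
case: i => [n|[|n]].
- by rewrite -PoszD addn1 /= expgSr.
- by rewrite [RHS]mulVg.
- have -> : (Negz n.+1 + 1)%R = Negz n by rewrite !NegzE; ring.
  by rewrite /= -!expVgn (expgSr x^-1 n.+1) mulgVK.
Qed.

Lemma expgzD x i j : expgz x (i + j)%R = expgz x i * expgz x j.
Proof.
have Dn (n : nat) i' : expgz x (i' + n%:Z)%R = expgz x i' * x ^+ n.
  elim: n => [|n IHn]; first by rewrite addr0 expg0 mulg1.
  by rewrite -addn1 PoszD addrA expgzS IHn addn1 -mulgA -expgSr.
case: j => [n|n] /=; first exact: Dn.
apply: (mulIg (x ^+ n.+1)); rewrite mulgVK -Dn; congr expgz.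
by rewrite NegzE; ring.
Qed.

Lemma expgzN x i : expgz x (- i)%R = (expgz x i)^-1.
Proof. by apply: (mulgI (expgz x i)); rewrite -expgzD subrr mulgV. Qed.

Lemma expgzM x i j : expgz x (i * j)%R = expgz (expgz x i) j.
Proof.
have Mn (n : nat) : expgz x (i * n%:Z)%R = expgz x i ^+ n.
  elim: n => [|n IHn]; first by rewrite mulr0.
  by rewrite -addn1 PoszD mulrDr mulr1 expgzD IHn addn1 -expgSr.
case: j => [n|n] /=; first exact: Mn.
by rewrite NegzE mulrN expgzN Mn.
Qed.

Lemma commutez x y i : commute x y -> commute x (expgz y i).
Proof.
move=> xy; case: i => n /=; [exact: commuteX | exact/commuteV/commuteX].
Qed.

Lemma expgzMn x y i :
  commute x y -> expgz (x * y) i = expgz x i * expgz y i.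
Proof.
move=> xy; case: i => n /=; first exact: expgMn.
rewrite expgMn // invgM.
have yx := commuteX2 n.+1 n.+1 (commute_sym xy).
exact (commute_sym (commuteV (commute_sym (commuteV yx)))).
Qed.

Lemma expgz_invg x i : expgz x^-1 i = (expgz x i)^-1.
Proof. by case: i => n /=; rewrite expVgn ?invgK. Qed.

End IntPowers.

Lemma homz (G H : groupType) (f : G -> H) x i :
  {morph f : x y / x * y} -> f (expgz x i) = expgz (f x) i.
Proof. by move=> fM; case: i => n; rewrite /= ?(homV fM) (homX fM). Qed.

Section FreeGroupMaps.
Variables (X : choiceType) (G : groupType).

Definition letter_val (f : X -> G) (l : X * bool) : G :=
  if l.2 then (f l.1)^-1 else f l.1.

Lemma free_extE f (w : free_group X) :
  free_ext f w = \prod_(l <- word w) letter_val f l.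
Proof. by []. Qed.

Lemma letter_val_linv f l : letter_val f (linv l) = (letter_val f l)^-1.
Proof. by case: l => x [] /=; rewrite /letter_val /= ?invgK. Qed.

Lemma prod_lmul f l w :
  \prod_(l <- lmul l w) letter_val f l =
  letter_val f l * \prod_(l <- w) letter_val f l.
Proof.
case: w => [|l' w] /=; first by rewrite !big_cons !big_nil.
case: eqP => [->|_]; last by rewrite !big_cons.
by rewrite big_cons letter_val_linv mulVKg.
Qed.

Lemma free_extM f : {morph @free_ext X G f : u v / u * v}.
Proof.
move=> u v; rewrite !free_extE /=.
elim: (word u) => [|l w IHw] /=; first by rewrite big_nil mul1g.
by rewrite prod_lmul IHw big_cons mulgA.
Qed.

Lemma free_ext_fgen f x : @free_ext X G f (fgen x) = f x.
Proof. by rewrite free_extE /= big_seq1. Qed.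

End FreeGroupMaps.

Section FreeGroupInd.
Variable X : choiceType.

(** Induction on the word, the letters being peeled off on the left. *)
Lemma free_group_ind (P : free_group X -> Prop) :
  P 1 -> (forall u v, P u -> P v -> P (u * v)) ->
  (forall u, P u -> P u^-1) -> (forall x, P (fgen x)) -> forall w, P w.
Proof.
move=> P1 PM PV Pg [w rw]; elim: w rw => [|l w IHw] rw.
  by rewrite (_ : Free rw = 1) //; apply/val_inj.
have rw' : reduced w by case/andP: (rw).
have -> : Free rw = (if l.2 then (fgen l.1)^-1 else fgen l.1) * Free rw'.
  apply/val_inj; case: l rw => x [] rw /=;
    case: w rw rw' {IHw} => //= l' w /andP[/negbTE h _] _;
    by rewrite h.
by apply: PM; [case: l.2; [exact/PV|]; apply: Pg | apply: IHw].
Qed.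

Lemma free_hom_eq (G : groupType) (f g : free_group X -> G) :
  {morph f : x y / x * y} -> {morph g : x y / x * y} ->
  (forall x, f (fgen x) = g (fgen x)) -> f =1 g.
Proof.
move=> fM gM fg; elim/free_group_ind => //.
- by rewrite (hom1 fM) (hom1 gM).
- by move=> u v hu hv; rewrite fM gM hu hv.
- by move=> u hu; rewrite (homV fM) (homV gM) hu.
Qed.

End FreeGroupInd.

Section Quotients.
Variables (G : groupType) (N : normal_subgroup G).

Lemma qproj_hom : {morph qproj N : x y / x * y}.
Proof. by move=> x y; rewrite -qprojM. Qed.

Lemma qproj_eq1 x : qproj N x = 1 <-> nsub N x.
Proof.
have <- : qproj N 1 = 1 by apply: (hom1 qproj_hom).
split=> [/esym/qprojP|h]; first by rewrite invg1 mul1g.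
by apply/esym/qprojP; rewrite invg1 mul1g.
Qed.

Section Lift.
Variables (H : groupType) (f : G -> H) (fM : {morph f : x y / x * y}).
Hypothesis fN : forall x, nsub N x -> f x = 1.

Definition qlift (u : quot N) : H := f (repr u).

Lemma qlift_qproj x : qlift (qproj N x) = f x.
Proof.
rewrite /qlift; have /qprojP/fN := qprojK (qproj N x).
rewrite fM (homV fM) => h; apply: (mulgI (f (repr (qproj N x)))^-1).
by rewrite h mulVg.
Qed.

Lemma qliftM : {morph qlift : u v / u * v}.
Proof.
move=> u v; have [x ->] := qproj_surj u; have [y ->] := qproj_surj v.
by rewrite -qproj_hom !qlift_qproj fM.
Qed.

End Lift.
End Quotients.

Section Kernel.
Variables (G H : groupType) (f : G -> H) (fM : {morph f : x y / x * y}).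

Definition ker_set : set G := [set x | f x = 1]%classic.

Fact ker1 : ker_set 1. Proof. exact: hom1. Qed.
Fact kerM x y : ker_set x -> ker_set y -> ker_set (x * y).
Proof. by rewrite /ker_set /= fM => -> ->; rewrite mulg1. Qed.
Fact kerV x : ker_set x -> ker_set x^-1.
Proof. by rewrite /ker_set /= (homV fM) => ->; rewrite invg1. Qed.
Fact kerJ x y : ker_set x -> ker_set (x ^ y).
Proof.
by rewrite /ker_set /= /conjg !fM (homV fM) => ->; rewrite mul1g mulVg.
Qed.

Definition kernel : normal_subgroup G := NormalSubgroup ker1 kerM kerV kerJ.

End Kernel.

Lemma nclosure_sub (G : groupType) (R : set G) x :
  R x -> nsub (nclosure R) x.
Proof. by move=> Rx N; apply. Qed.

(** The relations of the presentation by [al], [be], [c], [s] described above.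
*)
Definition relations p k (H : groupType) (A B C S : H) : Prop :=
  [/\ A ^+ p = B ^+ p, commute C (A ^+ p)
    & C * S = S * (A ^+ k * B ^- k * C)].

(** The universal property is stated for one homomorphism at a time; its
uniqueness is the consequence [marking_hom_eq] of the induction principle. *)
Record marking p k (G : groupType) := Marking {
  al : G; be : G; cc : G; ss : G;
  marking_rel : relations p k al be cc ss;
  marking_hom : forall (H : groupType) (A B C S : H), relations p k A B C S ->
    exists f : G -> H,
      {morph f : x y / x * y} /\
      [/\ f al = A, f be = B, f cc = C & f ss = S];
  marking_ind : forall P : G -> Prop,
    P 1 -> (forall x y, P x -> P y -> P (x * y)) ->
    (forall x, P x -> P x^-1) ->
    P al -> P be -> P cc -> P ss -> forall x, P x }.
Arguments marking_ind [p k G] m [P].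

(** The Bezout combination generating the abelian group of [a] and [h]: modulo
[a^p h^q = 1] both [a] and [h] are powers of it. *)
Lemma commute_expgz_root (G : groupType) (a h : G) (p : nat) (q u v : int) :
  commute a h -> a ^+ p * expgz h q = 1 -> (u * p%:Z + v * q = 1)%R ->
  let x := expgz a (- v)%R * expgz h u in
  x ^+ p = h /\ expgz x (- q)%R = a.
Proof.
move=> ah apq uv x.
have Ea : expgz a p = expgz h (- q)%R.
  by rewrite expgzN -(mulg1_eq apq) invgK.
have xE n : expgz x n = expgz a (- v * n)%R * expgz h (u * n)%R.
  rewrite expgzMn ?expgzM //; apply: commutez; apply: commute_sym.
  exact/commutez/commute_sym.
split.
  rewrite -[x ^+ p]/(expgz x p) xE [(- v * _)%R]mulrC [expgz a _]expgzM Ea -expgzM -expgzD.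
  rewrite (_ : (_ + _)%R = 1%R) ?[expgz _ _]expg1 // -uv; ring.
rewrite xE (_ : (u * - q = - q * u)%R) ?[expgz h _]expgzM; last by ring.
rewrite -Ea -expgzM -expgzD (_ : (_ + _)%R = 1%R) ?[expgz _ _]expg1 //.
by rewrite -uv; ring.
Qed.

(** The exponent [- q] may be changed by multiples of [p] because [x] and [y]
have the same [p]-th power. *)
Lemma expgz_ratio (G : groupType) (x y : G) (p k : nat) (q : int) :
  x ^+ p = y ^+ p -> (k%:Z = - q %[mod p%:Z])%Z ->
  expgz x (- q)%R * expgz y q = x ^+ k * y ^- k.
Proof.
move=> xy /eqP; rewrite eqz_mod_dvd => /dvdzP[t Et].
have Eq : (- q = k%:Z + p%:Z * - t)%R by rewrite mulrN mulrC -Et; ring.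
rewrite -[q in expgz y q]opprK [expgz y _]expgzN Eq !expgzD !expgzM /= xy.
by rewrite invgM mulgA mulgK.
Qed.

Lemma conj_relE (G : groupType) (s c w : G) :
  s^-1 * c * s * w^-1 = 1 -> c * s = s * w.
Proof. by move=> /divg1_eq <-; rewrite -!mulgA mulVKg. Qed.

Lemma hnn_rel (P : presentation) (u v w : free_group (pgens P)) :
  prels w ->
  qproj (nclosure (prels (p := hnn u v)))
    (free_ext (fun x => fgen (Some x)) w) = 1.
Proof. by move=> Rw; apply/qproj_eq1/nclosure_sub; left; exists w. Qed.

(** The relation for [b] is the one for [a] with [b^-1] in place of [b], which
gives the second root of [h]. In the converse direction [a = al^-q], [b =
be^q] and [h = al^p] satisfy the relations of the presentation. *)
Lemma G_marking p (q : int) (k : nat) :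
  coprimez p%:Z q -> (k%:Z = - q %[mod p%:Z])%Z -> marking p k (G_ p q).
Proof.
move=> cop Ek.
have /cid[[u v] /= uv] : exists uv : int * int,
    (uv.1 * p%:Z + uv.2 * q = 1)%R.
  have [u [v uv]] := Bezoutz p%:Z q; exists (u, v) => /=.
  by rewrite uv; apply/eqP.
pose gA := pgens (A_pres p q).
pose u0 : free_group gA := fgen gen_c.
pose v0 : free_group gA := fgen gen_a * fgen gen_b * fgen gen_c.
pose N := nclosure (prels (p := hnn u0 v0)).
pose lift : free_group gA -> free_group (option gA) :=
  free_ext (fun x => fgen (Some x)).
have liftM : {morph lift : x y / x * y} by exact: free_extM.
pose Q : free_group gA -> G_ p q := qproj N \o lift.
have QM : {morph Q : x y / x * y} by apply: hom_comp liftM (qproj_hom N).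
pose a := Q (fgen gen_a); pose b := Q (fgen gen_b).
pose c := Q (fgen gen_c); pose h := Q (fgen gen_h).
pose s : G_ p q := qproj N (fgen None).
have Qrel w : prels (p := A_pres p q) w -> Q w = 1.
  by move=> Rw; apply: hnn_rel.
have comm w : Q [~ fgen gen_h, w] = 1 -> commute (Q w) h.
  rewrite /commg /conjg !QM !(homV QM) => /eqP.
  by rewrite -[X in X == _]/[~ h, Q w] => /commgP/commute_sym.
have ah : commute a h by apply/comm/Qrel; left; apply: Or31.
have bh : commute b h by apply/comm/Qrel; left; apply: Or32.
have ch : commute c h by apply/comm/Qrel; left; apply: Or33.
have ap : a ^+ p * expgz h q = 1.
  rewrite /a /h -(homX QM) -(homz _ _ QM) -QM.
  by apply: Qrel; right; left.
have bp : b ^+ p * expgz h (- q)%R = 1.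
  rewrite /b /h -(homX QM) -(homz _ _ QM) -QM.
  by apply: Qrel; right; right.
have cs : c * s = s * (a * b * c).
  have : qproj N ((fgen None)^-1 * lift u0 * fgen None * (lift v0)^-1) = 1.
    by apply/qproj_eq1/nclosure_sub; right.
  rewrite !qproj_hom !(homV (qproj_hom N)) -[qproj N (fgen _)]/s.
  rewrite -[qproj N (lift u0)]/c -[qproj N (lift v0)]/(Q v0) /v0 !QM.
  exact: conj_relE.
have bVp : b^-1 ^+ p * expgz h q = 1.
  by rewrite expVgn (mulg1_eq bp) -expgzD addNr.
have bVh : commute b^-1 h by apply/commute_sym/commuteV/commute_sym.
have /= [] := commute_expgz_root ah ap uv.
have /= [] := commute_expgz_root bVh bVp uv.
set x := _ * expgz h u; set y := expgz a _ * expgz h u => xp xq yp yq.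
have Eb : expgz x q = b by apply: invg_inj; rewrite -expgzN xq.
have rel : relations p k y x c s.
  split; [by rewrite yp xp | by rewrite yp |].
  by rewrite -(expgz_ratio (etrans yp (esym xp)) Ek) yq Eb cs.
refine (Marking rel _ _).
  move=> H A B C S [AB CA CS].
  pose f0 (o : option abch) : H := match o with
    | Some gen_a => expgz A (- q)%R | Some gen_b => expgz B q
    | Some gen_c => C | Some gen_h => A ^+ p | None => S end.
  pose F : free_group (option gA) -> H := free_ext f0.
  have FM : {morph F : x y / x * y} by exact: free_extM.
  have Fg o : F (fgen o) = f0 o by exact: free_ext_fgen.
  have FlM := hom_comp liftM FM.
  have Flg z : F (lift (fgen z)) = f0 (Some z).
    by rewrite /lift free_ext_fgen Fg.
  have FN z : nsub N z -> F z = 1.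
    move=> /(_ (kernel FM)); apply=> _ [[w Rw <-]|->]; rewrite /= /ker_set /=.
      move: Rw => [[->|->|->]|[->|->]]; rewrite -[LHS]/((F \o lift) _).
      - rewrite /commg /conjg !FlM !(homV FlM) /= !Flg /=.
        by apply/eqP/commgP/commute_sym; rewrite -[_ ^+ p]/(expgz _ p); 
           apply/commutez/commute_sym/commutez/commute_refl.
      - rewrite /commg /conjg !FlM !(homV FlM) /= !Flg /= AB.
        by apply/eqP/commgP/commute_sym; rewrite -[_ ^+ p]/(expgz _ p); 
           apply/commutez/commute_sym/commutez/commute_refl.
      - rewrite /commg /conjg !FlM !(homV FlM) /= !Flg /=.
        by apply/eqP/commgP/commute_sym.
      - rewrite FlM (homX FlM) (homz _ _ FlM) /= !Flg /=.
        rewrite -[X in X * _]/(expgz _ p) -[A ^+ p]/(expgz A p) -!expgzM.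
        by rewrite -expgzD (_ : (_ + _)%R = 0%R) //; ring.
      - rewrite FlM (homX FlM) (homz _ _ FlM) /= !Flg /= AB.
        rewrite -[X in X * _]/(expgz _ p) -[B ^+ p]/(expgz B p) -!expgzM.
        by rewrite -expgzD (_ : (_ + _)%R = 0%R) //; ring.
    rewrite !FM !(homV FM) Fg /= -/lift -[F (lift v0)]/((F \o lift) v0) !FlM /=.
    rewrite !Flg /= (expgz_ratio AB Ek).
    by rewrite -(mulgA S^-1) CS mulKg mulgV.
  pose f : G_ p q -> H := qlift F.
  have fM : {morph f : x y / x * y} by exact: qliftM.
  have fQ z : f (Q z) = F (lift z) by apply: qlift_qproj.
  have fs : f s = S by rewrite /f /s qlift_qproj // Fg.
  have fa : f a = expgz A (- q)%R by rewrite fQ Flg.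
  have fb : f b = expgz B q by rewrite fQ Flg.
  have fc : f c = C by rewrite fQ Flg.
  have fh : f h = A ^+ p by rewrite fQ Flg.
  exists f; split=> //; split=> //.
  - rewrite /y fM !(homz _ _ fM) fa fh -expgzM -[A ^+ p]/(expgz A p) -expgzM.
    rewrite -expgzD (_ : (_ + _)%R = 1%R) ?[expgz _ _]expg1 // -uv; ring.
  - rewrite /x fM !(homz _ _ fM) (homV fM) fb fh AB expgz_invg -expgzN.
    rewrite -expgzM -[B ^+ p]/(expgz B p) -expgzM.
    rewrite -expgzD (_ : (_ + _)%R = 1%R) ?[expgz _ _]expg1 // -uv; ring.
move=> P P1 PM PV Py Px Pc Ps g.
have PX z n : P z -> P (z ^+ n).
  move=> Pz; elim: n => [|n IHn]; rewrite ?expg0 ?expgS //; exact: PM.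
have Pz z n : P z -> P (expgz z n).
  by move=> Pz; case: n => n /=; [|apply: PV]; apply: PX.
have [w ->] := qproj_surj g.
elim/free_group_ind: w => [|w1 w2|w1|[z|]].
- by have := hom1 (qproj_hom N) => ->.
- by rewrite qproj_hom; apply: PM.
- by rewrite (homV (qproj_hom N)); apply: PV.
- have -> : qproj N (fgen (Some z)) = Q (fgen z).
    by rewrite /Q /= /lift free_ext_fgen.
  case: z; rewrite -?[Q _]/a -?[Q _]/b -?[Q _]/c -?[Q _]/h //.
  + by rewrite -yq; apply: Pz.
  + by rewrite -Eb; apply: Pz.
  + by rewrite -xp; apply: PX.
- exact: Ps.
Qed.

Lemma marking_hom_eq p k (G H : groupType) (M : marking p k G)
    (f g : G -> H) :
  {morph f : x y / x * y} -> {morph g : x y / x * y} ->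
  f (al M) = g (al M) -> f (be M) = g (be M) -> f (cc M) = g (cc M) ->
  f (ss M) = g (ss M) -> f =1 g.
Proof.
move=> fM gM fa fb fc fs; elim/(marking_ind M) => //.
- by rewrite (hom1 fM) (hom1 gM).
- by move=> x y hx hy; rewrite fM gM hx hy.
- by move=> x hx; rewrite (homV fM) (homV gM) hx.
Qed.

Lemma marking_iso p k (G G' : groupType) :
  marking p k G -> marking p k G' -> group_iso G G'.
Proof.
move=> M M'.
have [f [fM [fa fb fc fs]]] := marking_hom M (marking_rel M').
have [g [gM [ga gb gc gs]]] := marking_hom M' (marking_rel M).
exists f => //; exists g.
  apply: (marking_hom_eq (M := M) (hom_comp fM gM)) => //=;
    by rewrite (fa, fb, fc, fs).
apply: (marking_hom_eq (M := M') (hom_comp gM fM)) => //=;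
  by rewrite (ga, gb, gc, gs).
Qed.

Lemma ratio_mod (G : groupType) (x y : G) p m n :
  x ^+ p = y ^+ p -> m = n %[mod p] -> x ^+ m * y ^- m = x ^+ n * y ^- n.
Proof.
move=> xy; suff E i : x ^+ i * y ^- i = x ^+ (i %% p) * y ^- (i %% p).
  by move=> mn; rewrite E mn -E.
rewrite {1 2}(divn_eq i p) addnC !expgnDr invgM mulnC !expgnA xy.
by rewrite mulgA mulgK.
Qed.

Lemma relations_scale p k k' (G : groupType) (A B C S : G) K :
  relations p k' A B C S -> K * k = k' %[mod p] ->
  relations p k (A ^+ K) (B ^+ K) C S.
Proof.
move=> [AB CA CS] Ek; split.
- by rewrite -!expgnA mulnC !expgnA AB.
- by rewrite -expgnA mulnC expgnA; apply: commuteX.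
- by rewrite -!expgnA CS (ratio_mod AB Ek).
Qed.

(** This is [relations_scale] for the exponent -1, stated separately because
the substitution is then invertible in every group. *)
Lemma relations_inv p k k' (G : groupType) (A B C S : G) :
  p %| k + k' -> relations p k A B C S -> relations p k' A^-1 B^-1 C S.
Proof.
move=> /dvdnP[t Et] [AB CA CS]; split; first by rewrite !expVgn AB.
  by rewrite expVgn; apply: commuteV.
rewrite CS; congr (_ * (_ * _)); rewrite !expVgn invgK.
apply: (mulIg (B ^+ k)); apply: (mulgI (A ^+ k')).
rewrite mulgVK -expgnDr addnC Et mulnC expgnA AB -expgnA mulnC -Et.
by rewrite -mulgA mulVKg -expgnDr addnC.
Qed.

Lemma marking_inv p k k' (G : groupType) :
  p %| k + k' -> marking p k G -> marking p k' G.
Proof.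
move=> kk' M; refine (Marking (relations_inv kk' (marking_rel M)) _ _).
  move=> H A B C S; rewrite addnC in kk' => /(relations_inv kk') rel.
  have [f [fM [fa fb fc fs]]] := marking_hom M rel.
  by exists f; rewrite !(homV fM) fa fb !invgK.
move=> P P1 PM PV Pa Pb; apply: (marking_ind M) => //.
- by rewrite -[al M]invgK; apply: PV.
- by rewrite -[be M]invgK; apply: PV.
Qed.

(** * The fibration over the integers *)
Section IntegerIterates.
Variables (T : Type) (f g : T -> T) (fK : cancel f g) (gK : cancel g f).

Definition ziter (i : int) (x : T) : T :=
  match i with Posz n => iter n f x | Negz n => iter n.+1 g x end.

Lemma ziterS i x : ziter (i + 1)%R x = f (ziter i x).
Proof.
case: i => [n|[|n]]; first by rewrite -PoszD addn1.
  by rewrite /= gK.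
have -> : (Negz n.+1 + 1)%R = Negz n by rewrite !NegzE; ring.
by rewrite [ziter (Negz n.+1) x]/= gK.
Qed.

Lemma ziterD i j x : ziter (i + j)%R x = ziter i (ziter j x).
Proof.
have Dn (n : nat) j' : ziter (n%:Z + j')%R x = iter n f (ziter j' x).
  elim: n => [|n IHn]; first by rewrite add0r.
  by rewrite -addn1 PoszD addrAC ziterS IHn addn1.
case: i => [n|n]; first exact: Dn.
have <- : iter n.+1 f (ziter (Negz n + j)%R x) = ziter j x.
  by rewrite -Dn addrA NegzE subrr add0r.
rewrite /ziter -/ziter.
have iterK m y : iter m g (iter m f y) = y.
  by elim: m => // m IHm; rewrite iterSr [iter m.+1 f y]iterS fK.
by rewrite iterK.
Qed.

End IntegerIterates.

Section Automorphism.
Variables (N : groupType) (f g : N -> N).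
Hypotheses (fK : cancel f g) (gK : cancel g f).
Hypothesis fM : {morph f : x y / x * y}.

Lemma ziterM i : {morph ziter f g i : x y / x * y}.
Proof.
have gM : {morph g : x y / x * y}.
  by move=> x y; apply: (can_inj fK); rewrite fM !gK.
have iterM (h : N -> N) n : {morph h : x y / x * y} ->
    {morph iter n h : x y / x * y}.
  by move=> hM x y; elim: n => //= n ->; rewrite hM.
by case: i => n; apply: iterM.
Qed.

Definition automorphism_action : zaction N :=
  @ZAction N (ziter f g) (fun x => erefl) (ziterD fK gK) ziterM.

End Automorphism.

(** [basisU i], [basisV i] and [basisS] stand for [al^i c^-i], [be^i c^-i] and
[s]. Since [al^p = be^p], the last [basisV] is the last [basisU], and the
other ones fill the [2 p] generators. *)
Section Basis.
Variables (p : nat) (p_gt1 : 1 < p).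

Definition basis_elt (n : nat) : F_ (2 * p) :=
  if insub n is Some i then fgen i else 1.

Definition basisU (i : nat) : F_ (2 * p) := if i is i'.+1 then basis_elt i' else 1.
Definition basisV (i : nat) : F_ (2 * p) :=
  if i == 0 then 1 else if i == p then basisU p else basis_elt (p + i.-1).
Definition basisS : F_ (2 * p) := basis_elt (2 * p).-1.

Lemma basisV_p : basisV p = basisU p.
Proof. by rewrite /basisV eqxx ifF //; lia. Qed.

(** Homomorphisms out of the free group, prescribed on this basis. *)
Section Extension.
Variables (H : groupType) (u v : nat -> H) (z : H).
Hypotheses (u0 : u 0 = 1) (v0 : v 0 = 1) (uvp : u p = v p).

Definition basis_ext : F_ (2 * p) -> H :=
  free_ext (fun i : 'I_(2 * p) =>
    if i < p then u i.+1 else if i < (2 * p).-1 then v (i - p).+1 else z).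

Lemma basis_extM : {morph basis_ext : x y / x * y}.
Proof. exact: free_extM. Qed.

Lemma basis_ext_elt n (n_lt : n < 2 * p) : basis_ext (basis_elt n) =
  if n < p then u n.+1 else if n < (2 * p).-1 then v (n - p).+1 else z.
Proof. by rewrite /basis_elt insubT /basis_ext free_ext_fgen. Qed.

Lemma basis_extU i : i <= p -> basis_ext (basisU i) = u i.
Proof.
case: i => [|i] ip; first by rewrite (hom1 basis_extM) u0.
by rewrite basis_ext_elt ?ip //; lia.
Qed.

Lemma basis_extV i : i <= p -> basis_ext (basisV i) = v i.
Proof.
case: i => [|i] ip; first by rewrite (hom1 basis_extM) v0.
rewrite /basisV /=; case: eqP => [->|/eqP np]; first by rewrite basis_extU.
rewrite basis_ext_elt; last by lia.
by rewrite ltnNge leq_addr /= addKn ifT //; lia.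
Qed.

Lemma basis_extS : basis_ext basisS = z.
Proof.
rewrite basis_ext_elt; last by lia.
by rewrite ltnn ifF //; lia.
Qed.

End Extension.

Lemma basis_hom_eq (H : groupType) (f g : F_ (2 * p) -> H) :
  {morph f : x y / x * y} -> {morph g : x y / x * y} ->
  (forall i, 0 < i <= p -> f (basisU i) = g (basisU i)) ->
  (forall i, 0 < i < p -> f (basisV i) = g (basisV i)) ->
  f basisS = g basisS -> f =1 g.
Proof.
move=> fM gM fU fV fS; apply: free_hom_eq => // i.
have -> : fgen i = basis_elt i.
  by rewrite /basis_elt insubT //= => lti; congr fgen; apply/val_inj.
have [ip|pi] := ltnP i p; first exact: (fU i.+1).
have [ip2|pi2] := ltnP i (2 * p).-1.
  have : 0 < (i - p).+1 < p by lia.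
  move=> /[dup]/andP[_ ipp] /fV; rewrite /basisV /= ltn_eqF // subnKC //.
suff -> : val i = (2 * p).-1 by [].
by have := ltn_ord i; move: pi2 => /=; lia.
Qed.

(** Conjugation by [c]: since [c (al^i c^-i) c^-1] equals [(al c^-1)^-1
(al^(i+1) c^-(i+1))], each basis element but the last is sent to a quotient of
two others, and the last one is fixed because [al^p] commutes with [c]. The
image of [s] comes from [c s c^-1 = s al^k be^-k]. *)
Section Monodromy.
Variables (k : nat) (k_gt0 : 0 < k) (k_lep : k <= p).

Definition monodromyU (i : nat) := if i == p then basisU p else (basisU 1)^-1 * basisU i.+1.
Definition monodromyV (i : nat) := if i == p then basisV p else (basisV 1)^-1 * basisV i.+1.
Definition monodromy : F_ (2 * p) -> F_ (2 * p) :=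
  basis_ext monodromyU monodromyV (basisS * (basisU k * (basisV k)^-1)).

Definition monodromy_invU i := if i is i'.+1 then basisU p * (basisU p.-1)^-1 * basisU i' else 1.
Definition monodromy_invV i := if i is i'.+1 then basisV p * (basisV p.-1)^-1 * basisV i' else 1.
Definition monodromy_inv : F_ (2 * p) -> F_ (2 * p) :=
  basis_ext monodromy_invU monodromy_invV (basisS * (monodromy_invU k * (monodromy_invV k)^-1)^-1).

Let p_neq0 : (0 == p) = false. Proof. lia. Qed.

Let monodromyU0 : monodromyU 0 = 1. Proof. by rewrite /monodromyU p_neq0 mulVg. Qed.
Let monodromyV0 : monodromyV 0 = 1. Proof. by rewrite /monodromyV p_neq0 mulVg. Qed.
Let monodromyUVp : monodromyU p = monodromyV p.
Proof. by rewrite /monodromyU /monodromyV eqxx basisV_p. Qed.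
Let monodromy_invUp : monodromy_invU p = basisU p.
Proof. by rewrite -[in monodromy_invU _](prednK (ltnW p_gt1)) /= mulgVK. Qed.
Let monodromy_invVp : monodromy_invV p = basisV p.
Proof. by rewrite -[in monodromy_invV _](prednK (ltnW p_gt1)) /= mulgVK. Qed.
Let monodromy_invUVp : monodromy_invU p = monodromy_invV p.
Proof. by rewrite monodromy_invUp monodromy_invVp basisV_p. Qed.

Lemma monodromyM : {morph monodromy : x y / x * y}. Proof. exact: basis_extM. Qed.
Lemma monodromy_invM : {morph monodromy_inv : x y / x * y}. Proof. exact: basis_extM. Qed.

Lemma monodromy_U i : i < p -> monodromy (basisU i) = (basisU 1)^-1 * basisU i.+1.
Proof. by move=> ip; rewrite /monodromy basis_extU 1?ltnW // /monodromyU ltn_eqF. Qed.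
Lemma monodromy_Up : monodromy (basisU p) = basisU p.
Proof. by rewrite /monodromy basis_extU // /monodromyU eqxx. Qed.
Lemma monodromy_V i : i < p -> monodromy (basisV i) = (basisV 1)^-1 * basisV i.+1.
Proof. by move=> ip; rewrite /monodromy basis_extV 1?ltnW // /monodromyV ltn_eqF. Qed.
Lemma monodromy_Vp : monodromy (basisV p) = basisV p.
Proof. by rewrite /monodromy basis_extV // /monodromyV eqxx. Qed.
Lemma monodromy_S : monodromy basisS = basisS * (basisU k * (basisV k)^-1).
Proof. exact: basis_extS. Qed.

Lemma monodromy_inv_U i : i < p -> monodromy_inv (basisU i.+1) = basisU p * (basisU p.-1)^-1 * basisU i.
Proof. by move=> ip; rewrite /monodromy_inv basis_extU. Qed.
Lemma monodromy_inv_V i : i < p -> monodromy_inv (basisV i.+1) = basisV p * (basisV p.-1)^-1 * basisV i.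
Proof. by move=> ip; rewrite /monodromy_inv basis_extV. Qed.
Lemma monodromy_inv_S : monodromy_inv basisS = basisS * (monodromy_inv (basisU k) * (monodromy_inv (basisV k))^-1)^-1.
Proof. by rewrite /monodromy_inv basis_extS basis_extU ?basis_extV. Qed.

Let monodromy_inv_KU i : i <= p -> monodromy (monodromy_inv (basisU i)) = basisU i.
Proof.
case: i => [|i] ip; first by rewrite (hom1 monodromy_invM) (hom1 monodromyM).
rewrite monodromy_inv_U // !monodromyM (homV monodromyM) monodromy_Up !monodromy_U ?prednK //; try lia.
by rewrite invgM invgK !mulgA mulgV mul1g mulgV mul1g.
Qed.

Let monodromy_inv_KV i : i <= p -> monodromy (monodromy_inv (basisV i)) = basisV i.
Proof.
case: i => [|i] ip; first by rewrite (hom1 monodromy_invM) (hom1 monodromyM).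
rewrite monodromy_inv_V // !monodromyM (homV monodromyM) monodromy_Vp !monodromy_V ?prednK //; try lia.
by rewrite invgM invgK !mulgA mulgV mul1g mulgV mul1g.
Qed.

Lemma monodromy_invK : cancel monodromy_inv monodromy.
Proof.
apply: (basis_hom_eq (hom_comp monodromy_invM monodromyM)) => //=.
- by move=> i /andP[_]; apply: monodromy_inv_KU.
- by move=> i /andP[_ /ltnW]; apply: monodromy_inv_KV.
rewrite monodromy_inv_S monodromyM (homV monodromyM) monodromyM (homV monodromyM) monodromy_S.
by rewrite monodromy_inv_KU // monodromy_inv_KV // mulgK.
Qed.

Lemma monodromyK : cancel monodromy monodromy_inv.
Proof.
have EU1 : monodromy_inv (basisU 1) = basisU p * (basisU p.-1)^-1.
  by rewrite monodromy_inv_U ?mulg1 //; lia.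
have EV1 : monodromy_inv (basisV 1) = basisV p * (basisV p.-1)^-1.
  by rewrite monodromy_inv_V ?mulg1 //; lia.
apply: (basis_hom_eq (hom_comp monodromyM monodromy_invM)) => //=.
- move=> i /andP[_]; rewrite leq_eqVlt => /predU1P[->|ip].
    by rewrite monodromy_Up /monodromy_inv basis_extU // monodromy_invUp.
  by rewrite monodromy_U // monodromy_invM (homV monodromy_invM) EU1 monodromy_inv_U // mulKg.
- move=> i /andP[_ ip].
  by rewrite monodromy_V // monodromy_invM (homV monodromy_invM) EV1 monodromy_inv_V // mulKg.
rewrite monodromy_S !monodromy_invM monodromy_inv_S (homV monodromy_invM) -!mulgA.
by rewrite mulVg mulg1.
Qed.

Definition monodromy_action := automorphism_action monodromyK monodromy_invK monodromyM.

End Monodromy.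
End Basis.

Section Fibration.
Variables (p k : nat) (p_gt1 : 1 < p) (k_gt0 : 0 < k) (k_ltp : k < p).

Let k_lep : k <= p. Proof. exact: ltnW. Qed.

Let phi : zaction (F_ (2 * p)) := monodromy_action p_gt1 k_gt0 k_lep.
Let pt (w : F_ (2 * p)) (n : int) : sdprodZ phi := (w, n).

Let ptM w n w' n' : pt w n * pt w' n' = pt (w * phi n w') (n + n')%R.
Proof. by []. Qed.

Let phi1 w : phi 1%R w = monodromy k w. Proof. by []. Qed.

Let phi_mul1 n : phi n 1 = 1. Proof. exact: zact1. Qed.

Let ptX (W : nat -> F_ (2 * p)) i : 0 < p -> W 0%N = 1 ->
  (forall i, i < p -> monodromy k (W i) = (W 1%N)^-1 * W i.+1) ->
  i <= p -> pt (W 1%N) 1%R ^+ i = pt (W i) i%:Z.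
Proof.
move=> p_gt0 W0 WS; elim: i => [|i IHi] ip; first by rewrite expg0 W0.
by rewrite expgS IHi 1?ltnW // ptM phi1 WS // mulVKg -PoszD.
Qed.

Let AX i : i <= p -> pt (basisU p 1) 1%R ^+ i = pt (basisU p i) i%:Z.
Proof.
move=> ip; apply: (ptX (W := basisU p)) => //; first by lia.
by move=> j jp; apply: monodromy_U.
Qed.

Let BX i : i <= p -> pt (basisV p 1) 1%R ^+ i = pt (basisV p i) i%:Z.
Proof.
move=> ip; apply: (ptX (W := basisV p)) => //; first by lia.
by move=> j jp; apply: monodromy_V.
Qed.

Let cX n : expgz (pt 1 1%R) n = pt 1 n.
Proof.
have cn (m : nat) : pt 1 1%R ^+ m = pt 1 m%:Z.
  by elim: m => [|m IHm] //; rewrite expgS IHm ptM phi_mul1 mulg1 -PoszD.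
case: n => [m|m] /=; first exact: cn.
apply/mulg1_eq; rewrite cn ptM phi_mul1 mulg1.
by rewrite NegzE addrN.
Qed.

Let model_relations :
  relations p k (pt (basisU p 1) 1%R) (pt (basisV p 1) 1%R) (pt 1 1%R) (pt (basisS p) 0%R).
Proof.
split; first by rewrite AX // BX // basisV_p.
  rewrite AX // /commute !ptM phi1 phi_mul1 mul1g mulg1 monodromy_Up //.
  by rewrite addrC.
rewrite AX 1?ltnW // BX 1?ltnW // mulgA.
have -> : pt (basisU p k) k%:Z / pt (basisV p k) k%:Z = pt (basisU p k * (basisV p k)^-1) 0%R.
  apply: (mulIg (pt (basisV p k) k%:Z)); rewrite mulgVK ptM zact0 mulgVK.
  by rewrite add0r.
by rewrite !ptM !zact0 phi1 mul1g mulg1 monodromy_S // !addr0 add0r.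
Qed.

Variables (G : groupType) (M : marking p k G).

Let j : F_ (2 * p) -> G :=
  basis_ext (fun i => al M ^+ i * cc M ^- i)
            (fun i => be M ^+ i * cc M ^- i) (ss M).

Let jM : {morph j : x y / x * y}. Proof. exact: basis_extM. Qed.

Let jU i : i <= p -> j (basisU p i) = al M ^+ i * cc M ^- i.
Proof. by move=> ip; rewrite /j basis_extU //= !expg0 mulgV. Qed.
Let jV i : i <= p -> j (basisV p i) = be M ^+ i * cc M ^- i.
Proof.
move=> ip; have [AB _ _] := marking_rel M.
by rewrite /j basis_extV //= ?AB // !expg0 mulgV.
Qed.
Let jS : j (basisS p) = ss M.
Proof. by rewrite /j basis_extS. Qed.

Let j_monodromy w : j (monodromy k w) = cc M * j w * (cc M)^-1.
Proof.
have [AB CA CS] := marking_rel M.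
pose conjc (x : G) := cc M * x * (cc M)^-1.
have conjcM : {morph conjc : x y / x * y}.
  by move=> x y; rewrite /conjc !mulgA mulgVK.
have monodromyM' : {morph @monodromy p k : x y / x * y} by apply: monodromyM.
have step (x : G) i : (x ^+ 1 * cc M ^- 1)^-1 * (x ^+ i.+1 * cc M ^- i.+1) =
    cc M * (x ^+ i * cc M ^- i) * (cc M)^-1.
  rewrite !expg1 invgM invgK expgS [cc M ^+ i.+1]expgS invgM.
  by rewrite -!mulgA mulKg.
have fixp (x : G) : x ^+ p = al M ^+ p ->
    x ^+ p * cc M ^- p = cc M * (x ^+ p * cc M ^- p) * (cc M)^-1.
  move=> ->; rewrite !mulgA CA -!mulgA; congr (_ * _).
  by rewrite -!expVgn -expgSr expgS mulVKg.
apply: (basis_hom_eq p_gt1 (hom_comp monodromyM' jM) (hom_comp jM conjcM)) => [i|i|];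
  rewrite /= /conjc.
- move=> /andP[_]; rewrite leq_eqVlt => /predU1P[->|ip].
    by rewrite monodromy_Up // jU //; apply: fixp.
  by rewrite monodromy_U // jM (homV jM) jU 1?ltnW // jU // jU 1?ltnW //.
- move=> /andP[_ ip].
  by rewrite monodromy_V // jM (homV jM) jV 1?ltnW // jV // jV 1?ltnW //.
rewrite monodromy_S // !jM (homV jM) jS jU 1?ltnW // jV 1?ltnW // CS.
by rewrite invgM invgK !mulgA mulgVK mulgK.
Qed.

Let j_phi n w : j (phi n w) = expgz (cc M) n * j w * (expgz (cc M) n)^-1.
Proof.
have jn (m : nat) w' : j (phi m w') = cc M ^+ m * j w' * cc M ^- m.
  elim: m => [|m IHm]; first by rewrite zact0 expg0 invg1 mul1g mulg1.
  by rewrite (intS m) zactD phi1 j_monodromy IHm expgS invgM !mulgA.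
case: n => [m|m]; first exact: jn.
have := jn m.+1 (phi (Negz m) w).
rewrite -zactD NegzE addrN zact0 => ->.
by rewrite -NegzE /= invgK !mulgA mulVg mul1g mulgVK.
Qed.

Let back (x : sdprodZ phi) : G := j x.1 * expgz (cc M) x.2.

Let backM : {morph back : x y / x * y}.
Proof.
move=> [w n] [w' n']; rewrite /back /= jM j_phi expgzD.
by rewrite !mulgA mulgVK.
Qed.

(** The homomorphism given by the universal property of the marking and the
map [(w, n) |-> j w c^n] are inverse to each other, as can be checked on
generators. *)
Lemma marking_fibration : exists psi : zaction (F_ (2 * p)),
  group_iso G (sdprodZ psi).
Proof.
exists phi; have [f [fM [fa fb fc fs]]] := marking_hom M model_relations.
have fcX n : f (expgz (cc M) n) = pt 1 n by rewrite (homz _ _ fM) fc cX.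
have fj w : f (j w) = pt w 0%R.
  have ptM0 : {morph (fun w => pt w 0%R) : x y / x * y}.
    by move=> x y; rewrite ptM zact0 addr0.
  have fx x (W : nat -> F_ (2 * p)) i : f x ^+ i = pt (W i) i%:Z ->
      f (x ^+ i * cc M ^- i) = pt (W i) 0%R.
    move=> E; rewrite fM (homX fM) E (homV fM) -[_ ^+ i]/(expgz (cc M) i).
    rewrite fcX -[pt 1 i](cX i) -expgzN cX ptM phi_mul1 mulg1.
    by rewrite addrN.
  apply: (basis_hom_eq p_gt1 (hom_comp jM fM) ptM0) => [i|i|] /=.
  - by move=> /andP[_ ip]; rewrite jU // (fx _ (basisU p)) // fa AX.
  - by move=> /andP[_ /ltnW ip]; rewrite jV // (fx _ (basisV p)) // fb BX.
  - by rewrite jS.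
have backE w n : back (pt w n) = j w * expgz (cc M) n by [].
exists f => //; exists back.
  apply: (marking_hom_eq (M := M) (hom_comp fM backM)) => //=;
    rewrite ?fa ?fb ?fc ?fs backE.
  - by rewrite jU ?(ltnW p_gt1) // !expg1 mulgVK.
  - by rewrite jV ?(ltnW p_gt1) // !expg1 mulgVK.
  - by rewrite (hom1 jM) mul1g.
  - by rewrite jS mulg1.
move=> [w n]; rewrite backE fM fj fcX ptM zact0 mulg1.
by rewrite add0r.
Qed.

End Fibration.

(** * Profinite completions *)
Section Congruences.
Local Open Scope nat_scope.

Lemma exists_inv_mod a n : coprime a n -> exists b, a * b = 1 %[mod n].
Proof.
case: n => [|n] an; first by exists 1%N; move: an; rewrite /coprime gcdn0 => /eqP->.
case: (posnP a) an => [->|a_gt0] an; last first.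
  case: (egcdnP n.+1 a_gt0) => b c Eb _; exists b.
  by rewrite mulnC Eb (eqP an) -modnDml modnMl.
by move: an; rewrite /coprime gcd0n => /eqP ->; exists 0%N; rewrite !modn1.
Qed.

Lemma eqn_mod_dvd_trans d n a b : d %| n -> a = b %[mod n] -> a = b %[mod d].
Proof. by move=> dn ab; rewrite -(modn_dvdm a dn) ab modn_dvdm. Qed.

Lemma eqn_modM a b c d n :
  a = b %[mod n] -> c = d %[mod n] -> a * c = b * d %[mod n].
Proof. by move=> ab cd; rewrite -modnMm ab cd modnMm. Qed.

(** A coherent sequence represents a profinite integer, [K n] being its
residue modulo [n]. *)
Definition coherent (K : nat -> nat) :=
  forall d n, 0 < n -> d %| n -> K n = K d %[mod d].

(** By the Chinese remainder theorem take [K] congruent to [k' / k] at the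
primes dividing [p] and to 1 at the other ones; it is invertible everywhere,
and [K'] is its inverse. *)
Lemma exists_profinite_unit p k k' : 1 < p -> coprime k p -> coprime k' p ->
  exists K K' : nat -> nat,
    [/\ coherent K, coherent K', forall n, 0 < n -> K n * K' n = 1 %[mod n],
        forall n, K n * k = k' %[mod p] & forall n, K' n * k' = k %[mod p]].
Proof.
move=> p_gt1 kp k'p; have p_gt0 := ltnW p_gt1.
have [b kb] := exists_inv_mod kp; pose r := k' * b.
have rk : r * k = k' %[mod p].
  by rewrite /r -mulnA [b * k]mulnC -modnMmr kb modnMmr muln1.
have rp : coprime r p.
  have : coprime (r * k) p by rewrite -coprime_modl rk coprime_modl.
  by rewrite coprimeMl => /andP[].
have r_gt0 : 0 < r.
  by case: (posnP r) rp => // ->; rewrite /coprime gcd0n => /eqP E; move: p_gt1; rewrite E.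
pose pi := (\pi(p) : nat_pred).
pose K n := chinese (p * n)`_pi (p * n)`_pi^' r 1.
have cop m n : coprime m`_pi n`_pi^'.
  by apply: (pnat_coprime (part_pnat pi _)); apply: part_pnat.
have K1 n : K n = r %[mod (p * n)`_pi] by apply/chinese_modl/cop.
have K2 n : K n = 1 %[mod (p * n)`_pi^'] by apply/chinese_modr/cop.
have ppi n : 0 < n -> p %| (p * n)`_pi.
  move=> n_gt0; rewrite -[X in X %| _](@part_pnat_id pi) ?pnat_pi //.
  by apply: partn_dvd; [rewrite muln_gt0 p_gt0 | apply: dvdn_mulr].
have Kc n : 0 < n -> coprime (K n) (p * n).
  move=> n_gt0; have pn_gt0 : 0 < p * n by rewrite muln_gt0 p_gt0.
  rewrite -(partnC pi pn_gt0) coprimeMr -coprime_modl K1 coprime_modl.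
  rewrite -[X in _ && X]coprime_modl K2 coprime_modl coprime1n andbT.
  rewrite coprime_sym; apply: (pnat_coprime (part_pnat pi _)).
  by rewrite -coprime_pi' // coprime_sym.
(* Coherence modulo [p d] is stronger than modulo [d] and is what makes the
   inverses coherent and congruent to [k / k'] modulo [p]. *)
have Kcoh d n : 0 < n -> d %| n -> K n = K d %[mod p * d].
  move=> n_gt0 dn; have d_gt0 := dvdn_gt0 n_gt0 dn.
  have pn_gt0 : 0 < p * n by rewrite muln_gt0 p_gt0.
  have pd_gt0 : 0 < p * d by rewrite muln_gt0 p_gt0.
  have pdpn : p * d %| p * n by rewrite dvdn_pmul2l.
  rewrite -(partnC pi pd_gt0); apply/eqP.
  rewrite chinese_remainder ?cop // K1 K2; apply/andP; split; apply/eqP.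
    by apply: eqn_mod_dvd_trans (K1 n); apply: partn_dvd.
  by apply: eqn_mod_dvd_trans (K2 n); apply: partn_dvd.
have /choice[K' K'P] : forall n, exists x, 0 < n -> K n * x = 1 %[mod p * n].
  move=> n; have [->|n_gt0] := posnP n; first by exists 0%N.
  by have [x] := exists_inv_mod (Kc n n_gt0); exists x.
have K'coh d n : 0 < n -> d %| n -> K' n = K' d %[mod p * d].
  move=> n_gt0 dn; have d_gt0 := dvdn_gt0 n_gt0 dn.
  have pdpn : p * d %| p * n by rewrite dvdn_pmul2l.
  have E1 := eqn_mod_dvd_trans pdpn (K'P n n_gt0).
  have := eqn_modM (erefl (K' n %% (p * d))) (K'P d d_gt0).
  have := eqn_modM (etrans (eqn_modM (esym (Kcoh _ _ n_gt0 dn))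
    (erefl (K' n %% (p * d)))) E1) (erefl (K' d %% (p * d))).
  by rewrite mul1n muln1 => <- <-; rewrite mulnCA mulnA.
have Kk n : 0 < n -> K n * k = k' %[mod p].
  move=> n_gt0; rewrite -rk; apply: eqn_modM => //.
  by apply: eqn_mod_dvd_trans (K1 n); apply: ppi.
have K'k n : 0 < n -> K' n * k' = k %[mod p].
  move=> n_gt0; have E := eqn_mod_dvd_trans (dvdn_mulr n (dvdnn p)) (K'P n n_gt0).
  have := eqn_modM (erefl (K' n %% p)) (Kk n n_gt0).
  have := eqn_modM E (erefl (k %% p)).
  by rewrite mul1n => <- <-; rewrite mulnA [K' n * _]mulnC.
exists (fun n => K n.-1.+1), (fun n => K' n.-1.+1); split.
- move=> d n n_gt0 dn; have d_gt0 := dvdn_gt0 n_gt0 dn; rewrite !prednK //.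
  by apply: eqn_mod_dvd_trans (Kcoh _ _ n_gt0 dn); apply: dvdn_mull.
- move=> d n n_gt0 dn; have d_gt0 := dvdn_gt0 n_gt0 dn; rewrite !prednK //.
  by apply: eqn_mod_dvd_trans (K'coh _ _ n_gt0 dn); apply: dvdn_mull.
- move=> n n_gt0; rewrite prednK //.
  by apply: eqn_mod_dvd_trans (K'P n n_gt0); apply: dvdn_mull.
- by move=> n; apply: Kk.
- by move=> n; apply: K'k.
Qed.

End Congruences.

Section TorsionPowers.
Variable G : groupType.

Lemma expg_mod_eq (x : G) n i j : x ^+ n = 1 -> i = j %[mod n] -> x ^+ i = x ^+ j.
Proof.
move=> xn ij; suff E m : x ^+ m = x ^+ (m %% n) by rewrite E ij -E.
by rewrite {1}(divn_eq m n) expgnDr mulnC expgnA xn expg1n mul1g.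
Qed.

Lemma expg_gcd_eq1 (x : G) m n : 0 < m -> x ^+ m = 1 -> x ^+ n = 1 ->
  x ^+ gcdn m n = 1.
Proof.
move=> m_gt0 xm xn; case: (egcdnP n m_gt0) => b c E _.
by have := xm => /(congr1 (fun y => y ^+ b)); rewrite expg1n -expgnA mulnC E
  expgnDr mulnC expgnA xn expg1n mul1g.
Qed.

(** Powers of a torsion element with a profinite exponent are well defined. *)
Lemma coherent_exp K (x : G) m n : coherent K -> 0 < m -> 0 < n ->
  x ^+ m = 1 -> x ^+ n = 1 -> x ^+ K m = x ^+ K n.
Proof.
move=> Kc m_gt0 n_gt0 xm xn; have xg := expg_gcd_eq1 m_gt0 xm xn.
by apply: (expg_mod_eq xg); rewrite (Kc _ _ m_gt0) ?(Kc _ _ n_gt0) ?dvdn_gcdl ?dvdn_gcdr.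
Qed.

(** Among the first powers of an element, as many as there are elements plus
one, two agree; the order thus divides the factorial. *)
Lemma finite_exponent : finite_set [set: G]%classic ->
  exists2 n, 0 < n & forall x : G, x ^+ n = 1.
Proof.
move=> /finite_seqP[s Es]; exists (size s)`!; first exact: fact_gt0.
move=> x; pose t := [seq x ^+ i | i <- iota 0 (size s).+1].
have t_sub : {subset t <= s}.
  by move=> y _; have : [set: G]%classic y by []; rewrite Es.
have /(uniqPn 1)[i [j [ij jt]]] : ~~ uniq t.
  by apply/negP => /uniq_leq_size/(_ t_sub); rewrite size_map size_iota ltnn.
rewrite size_map size_iota in jt.
rewrite !(nth_map 0) ?size_iota ?(ltn_trans ij jt) // !nth_iota ?(ltn_trans ij jt) //.
rewrite !add0n -(subnKC (ltnW ij)) expgnDr -[LHS]mulg1 => /mulgI/esym xd.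
have /dvdnP[d ->] : j - i %| (size s)`!.
  by apply: dvdn_fact; rewrite subn_gt0 ij (leq_trans (leq_subr _ _)).
by rewrite mulnC expgnA xd expg1n.
Qed.

End TorsionPowers.

Lemma relations_hom p k (G H : groupType) (f : G -> H) (A B C S : G) :
  {morph f : x y / x * y} -> relations p k A B C S ->
  relations p k (f A) (f B) (f C) (f S).
Proof.
move=> fM [AB CA CS]; split; first by rewrite -!(homX fM) AB.
  by rewrite /commute -(homX fM) -!fM CA.
by rewrite -!(homX fM) -(homV fM) -!fM CS.
Qed.

Section ProfiniteTopology.
Local Open Scope classical_set_scope.
Variable G : groupType.

Lemma nbhs_pcoord (x : profinite G) (N : fin_normal G) :
  nbhs x [set y | pcoord y N = pcoord x N].
Proof.
pose U : set (prod_finquot G) := [set z | z N = pcoord x N].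
have oU : open U.
  rewrite openE => z Uz; rewrite /interior.
  have /(_ N) cvgz := (@cvg_sup _ _ (fun M : fin_normal G => Topological.class
    (initial_topology (fun f : prod_finquot G => f M)))
    (nbhs z) z (nbhs_filter z)).1 cvg_id.
  apply: cvgz.
  exists U; split=> //.
  by exists [set pcoord x N] => //; apply: discrete_open.
apply: (@open_nbhs_nbhs (profinite G)); split => //.
by exists U.
Qed.

End ProfiniteTopology.

(** The topology of the completion is generated by the coordinates, whose
values are discrete. *)
Lemma profinite_continuous (G H : groupType) (f : profinite G -> profinite H) :
  (forall (x : profinite G) N, exists M, forall y : profinite G,
     pcoord y M = pcoord x M -> pcoord (f y) N = pcoord (f x) N) ->
  continuous f.
Proof.
move=> fP.
apply: (@continuous_comp_initial _ _ _ (@set_val _ (@compatible H)) f).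
move=> x; apply/(@cvg_sup _ _ (fun N : fin_normal H => Topological.class
    (initial_topology (fun z : prod_finquot H => z N))) _ _
    (fmap_filter _ (nbhs_filter x))) => N A [_ [[B oB <-] Bfx] sBA].
have [M xM] := fP x N; apply: filterS (nbhs_pcoord x M) => y /xM yx.
by apply: sBA; rewrite /= -[_ N]/(pcoord (f y) N) yx.
Qed.

(** A profinite exponent [K] with [K k = k'] modulo [p] induces a homomorphism
[theta N] from [G] to every finite quotient of [G'], and these are compatible.
A point of the completion of [G] has a coordinate at the kernel of [theta N],
which determines the coordinate at [N] of its image. *)
Section Transfer.
Variables (p k k' : nat) (G G' : groupType).
Variables (M : marking p k G) (M' : marking p k' G').
Variables (K : nat -> nat).
Hypotheses (Kc : coherent K) (Kk : forall n, K n * k = k' %[mod p]).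

Let exponent_ex (N : fin_normal G') :
  exists n, 0 < n /\ forall u : quot N, u ^+ n = 1.
Proof. by have [n] := finite_exponent (fnsub_finite N); exists n. Qed.

Definition quot_exponent (N : fin_normal G') : nat := sval (cid (exponent_ex N)).

Lemma quot_exponent_gt0 N : 0 < quot_exponent N.
Proof. exact: (svalP (cid (exponent_ex N))).1. Qed.

Lemma quot_exponentP (N : fin_normal G') (u : quot N) : u ^+ quot_exponent N = 1.
Proof. exact: (svalP (cid (exponent_ex N))).2. Qed.

Definition root_image (N : fin_normal G') (g : G') : quot N :=
  qproj N g ^+ K (quot_exponent N).

Let theta_ex (N : fin_normal G') : exists f : G -> quot N,
  {morph f : x y / x * y} /\
  [/\ f (al M) = root_image N (al M'), f (be M) = root_image N (be M'),
      f (cc M) = qproj N (cc M') & f (ss M) = qproj N (ss M')].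
Proof.
apply: marking_hom; apply: relations_scale (Kk _).
exact: relations_hom (qproj_hom N) (marking_rel M').
Qed.

Definition theta (N : fin_normal G') : G -> quot N := sval (cid (theta_ex N)).

Lemma thetaM N : {morph @theta N : x y / x * y}.
Proof. exact: (svalP (cid (theta_ex N))).1. Qed.

Lemma theta_gen N :
  [/\ theta N (al M) = root_image N (al M'), theta N (be M) = root_image N (be M'),
      theta N (cc M) = qproj N (cc M') & theta N (ss M) = qproj N (ss M')].
Proof. exact: (svalP (cid (theta_ex N))).2. Qed.

Fact theta_ker_finite N : finite_set [set: quot (kernel (@thetaM N))]%classic.
Proof.
pose f : quot (kernel (@thetaM N)) -> quot N := qlift (theta N).
have f_inj : injective f.
  move=> u v; have [x ->] := qproj_surj u; have [y ->] := qproj_surj v.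
  rewrite /f !qlift_qproj //; try exact: thetaM.
  move=> E; apply/qprojP; rewrite /= /ker_set /= thetaM (homV (@thetaM N)) E.
  by rewrite mulVg.
have : finite_set (f @` [set: quot (kernel (@thetaM N))])%classic.
  exact: sub_finite_set (fnsub_finite N).
by rewrite (eq_finite_set (inj_card_eq _)) //; apply: in2W.
Qed.

Definition theta_ker N : fin_normal G := FinNormal (@theta_ker_finite N).

(** The compatibility of the [theta N] when [N] grows: in the smaller quotient
the [K]-th powers may be computed with the exponent of the bigger one. *)
Lemma theta_qproj (N1 N2 : fin_normal G') g g' : (N1 `<=` N2)%classic ->
  theta N1 g = qproj N1 g' -> theta N2 g = qproj N2 g'.
Proof.
move=> N12; pose r : quot N1 -> quot N2 := qlift (qproj N2).
have N12' z : nsub N1 z -> qproj N2 z = 1 by move=> /N12/qproj_eq1.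
have rM : {morph r : x y / x * y} by apply: qliftM => //; apply: qproj_hom.
have rq z : r (qproj N1 z) = qproj N2 z.
  by apply: qlift_qproj => //; apply: qproj_hom.
have rK z : r (root_image N1 z) = root_image N2 z.
  rewrite /root_image (homX rM) rq; apply: coherent_exp => //; try exact: quot_exponent_gt0.
    by rewrite -rq -(homX rM) quot_exponentP (hom1 rM).
  exact: quot_exponentP.
have [a1 b1 c1 s1] := theta_gen N1; have [a2 b2 c2 s2] := theta_gen N2.
have E : r \o theta N1 =1 theta N2.
  apply: (marking_hom_eq (M := M) (hom_comp (@thetaM N1) rM) (@thetaM N2)) => /=.
  - by rewrite a1 a2 rK.
  - by rewrite b1 b2 rK.
  - by rewrite c1 c2 rq.
  - by rewrite s1 s2 rq.
by move=> h; rewrite -E /= h rq.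
Qed.

Definition transfer_coord (x : profinite G) (N : fin_normal G') : quot N :=
  theta N (repr (pcoord x (theta_ker N))).

Lemma transfer_coordE x N g :
  pcoord x (theta_ker N) = qproj (theta_ker N) g -> transfer_coord x N = theta N g.
Proof.
rewrite /transfer_coord => ->.
have /qprojP := qprojK (qproj (theta_ker N) g).
rewrite /= /ker_set /= thetaM (homV (@thetaM N)) => h.
by apply: (mulgI (theta N (repr (qproj (theta_ker N) g)))^-1); rewrite h mulVg.
Qed.

Fact transfer_compatible x : compatible (transfer_coord x).
Proof.
move=> N1 N2 N12 g'.
have [g Eg] := qproj_surj (pcoord x (theta_ker N1)).
rewrite (transfer_coordE Eg) => h; have h2 := theta_qproj N12 h.
rewrite -h2; apply: transfer_coordE; apply: (pcoordP _ Eg).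
move=> z; rewrite /= /ker_set /= => z1.
have := @theta_qproj N1 N2 z 1 N12; rewrite (hom1 (qproj_hom N1)) => /(_ z1).
by rewrite (hom1 (qproj_hom N2)).
Qed.

Definition transfer (x : profinite G) : profinite G' :=
  SigSub (mem_set (@transfer_compatible x)).

Lemma pcoord_transfer x N : pcoord (transfer x) N = transfer_coord x N.
Proof. by []. Qed.

Lemma transferM : {morph transfer : x y / x * y}.
Proof.
move=> x y; apply/pcoord_inj/functional_extensionality_dep => N.
have [g Eg] := qproj_surj (pcoord x (theta_ker N)).
have [h Eh] := qproj_surj (pcoord y (theta_ker N)).
rewrite -[RHS]/(pcoord (transfer x) N * pcoord (transfer y) N).
rewrite !pcoord_transfer (transfer_coordE Eg) (transfer_coordE Eh) -thetaM.
apply: transfer_coordE; rewrite qproj_hom -Eg -Eh //.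
Qed.

Lemma transfer_continuous : continuous transfer.
Proof.
apply: profinite_continuous => x N; exists (theta_ker N) => y yx.
by rewrite !pcoord_transfer /transfer_coord yx.
Qed.

End Transfer.

(** Let [N] be the kernel of [theta' L]. The composite of [theta N] with the
injection of the quotient by [N] into the quotient by [L] is the projection of
[G] onto the latter, because [K] and [K'] are inverse to each other. *)
Lemma transferK p k k' (G G' : groupType) (M : marking p k G)
    (M' : marking p k' G') (K K' : nat -> nat) (Kc : coherent K)
    (K'c : coherent K') (Kk : forall n, K n * k = k' %[mod p])
    (K'k : forall n, K' n * k' = k %[mod p]) :
  (forall n, 0 < n -> K n * K' n = 1 %[mod n]) ->
  cancel (transfer M M' Kc Kk) (transfer M' M K'c K'k).
Proof.
move=> KK x; apply/pcoord_inj/functional_extensionality_dep => L.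
rewrite pcoord_transfer.
pose N := theta_ker M' M K'k L.
have [g Eg] := qproj_surj (pcoord x (theta_ker M M' Kk N)).
have [g' Eg'] := qproj_surj (theta M M' Kk N g).
have -> : transfer_coord M' M K'k (transfer M M' Kc Kk x) L = theta M' M K'k L g'.
  by apply: transfer_coordE; rewrite pcoord_transfer (transfer_coordE Eg).
pose r : quot N -> quot L := qlift (theta M' M K'k L).
have rM : {morph r : x y / x * y} by apply: qliftM => //; apply: thetaM.
have rq z : r (qproj N z) = theta M' M K'k L z.
  by apply: qlift_qproj => //; apply: thetaM.
have [a1 b1 c1 s1] := theta_gen M M' Kk N.
have [a2 b2 c2 s2] := theta_gen M' M K'k L.
have r_inj : injective r.
  move=> u v; have [y ->] := qproj_surj u; have [z ->] := qproj_surj v.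
  rewrite !rq => E; apply/qprojP.
  by rewrite /= /ker_set /= thetaM (homV (@thetaM _ _ _ _ _ _ _ _ _ L)) E mulVg.
have hK z z' : theta M' M K'k L z' = root_image K' L z -> r (root_image K N z') = qproj L z.
  move=> E; rewrite /root_image (homX rM) rq E /root_image -expgnA mulnC.
  have rN : root_image K' L z ^+ quot_exponent N = 1.
    by rewrite -E -rq -(homX rM) quot_exponentP (hom1 rM).
  rewrite mulnC expgnA -/(root_image K' L z).
  rewrite (coherent_exp Kc (quot_exponent_gt0 N) (quot_exponent_gt0 L) rN (quot_exponentP _)).
  rewrite /root_image -expgnA mulnC.
  by rewrite (expg_mod_eq (quot_exponentP _) (KK _ (quot_exponent_gt0 L))) expg1.
(* In particular the kernel of [theta N] is contained in [L]. *)
have E : r \o theta M M' Kk N =1 qproj L.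
  apply: (marking_hom_eq (M := M) (hom_comp (@thetaM _ _ _ _ _ _ _ _ _ N) rM)
    (qproj_hom L)) => /=.
  - by rewrite a1; apply: hK.
  - by rewrite b1; apply: hK.
  - by rewrite c1 rq c2.
  - by rewrite s1 rq s2.
rewrite -rq -Eg' -[r _]/((r \o theta M M' Kk N) g) E; apply/esym.
apply: (pcoordP _ Eg) => z; rewrite /= /ker_set /= => z1.
by apply/qproj_eq1; rewrite -E /= z1 (hom1 rM).
Qed.

Theorem marking_profinite_iso p k k' (G G' : groupType) :
  1 < p -> coprime k p -> coprime k' p ->
  marking p k G -> marking p k' G' -> profinite_iso G G'.
Proof.
move=> p_gt1 kp k'p M M'.
have [K [K' [Kc K'c KK' Kk K'k]]] := exists_profinite_unit p_gt1 kp k'p.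
exists (transfer M M' Kc Kk), (transfer M' M K'c K'k); split.
- exact: transferK.
- by apply: transferK => n n_gt0; rewrite mulnC KK'.
- exact: transferM.
- exact: transfer_continuous.
- exact: transfer_continuous.
Qed.

(** * Groups of units and of affine maps *)
Definition addgroup (V : zmodType) : Type := V.

Section AdditiveGroup.
Variable V : zmodType.
HB.instance Definition _ := Choice.on (addgroup V).
HB.instance Definition _ := isGroup.Build (addgroup V)
  (@addrA V) (@add0r V) (@addr0 V) (@addNr V) (@addrN V).
End AdditiveGroup.

Definition units (R : unitRingType) : Type := {x : R | x \is a GRing.unit}.

Section UnitGroup.
Variable R : unitRingType.
HB.instance Definition _ :=
  SubChoice.copy (units R) {x : R | x \is a GRing.unit}.

Fact units_mul_subproof (x y : units R) : (val x * val y)%R \is a GRing.unit.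
Proof. by rewrite unitrMl (valP x, valP y). Qed.
Fact units_inv_subproof (x : units R) : (val x)^-1%R \is a GRing.unit.
Proof. by rewrite unitrV (valP x). Qed.

Definition units_one : units R := exist (fun z => z \is a GRing.unit) 1%R (unitr1 R).
Definition units_mul (x y : units R) : units R := exist (fun z => z \is a GRing.unit) _ (units_mul_subproof x y).
Definition units_inv (x : units R) : units R := exist (fun z => z \is a GRing.unit) _ (units_inv_subproof x).

Fact units_mulA : associative units_mul.
Proof. by move=> x y z; apply/val_inj; rewrite /= mulrA. Qed.
Fact units_mul1 : left_id units_one units_mul.
Proof. by move=> x; apply/val_inj; rewrite /= mul1r. Qed.
Fact units_mulr1 : right_id units_one units_mul.
Proof. by move=> x; apply/val_inj; rewrite /= mulr1. Qed.
Fact units_mulV : left_inverse units_one units_inv units_mul.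
Proof. by move=> x; apply/val_inj; rewrite /= mulVr ?(valP x). Qed.
Fact units_mulrV : right_inverse units_one units_inv units_mul.
Proof. by move=> x; apply/val_inj; rewrite /= divrr ?(valP x). Qed.

HB.instance Definition _ := isGroup.Build (units R)
  units_mulA units_mul1 units_mulr1 units_mulV units_mulrV.

Lemma val_unitsM (x y : units R) : val (x * y) = (val x * val y)%R.
Proof. by []. Qed.
Lemma val_unitsX (x : units R) n : val (x ^+ n) = (val x ^+ n)%R.
Proof. by elim: n => // n IHn; rewrite expgS exprS val_unitsM IHn. Qed.

End UnitGroup.

(** [x |-> a x + b] is encoded by the pair [(a, b)]. *)
Definition affine (K : fieldType) : Type := {z : K * K | z.1 != 0%R}.

Section AffineGroup.
Variable K : fieldType.
Local Open Scope ring_scope.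
HB.instance Definition _ :=
  SubChoice.copy (affine K) {z : K * K | z.1 != 0}.

Definition scale_part (z : affine K) : K := (val z).1.
Definition shift_part (z : affine K) : K := (val z).2.

Definition mk_affine (a b : K) (a0 : a != 0) : affine K := exist (fun z : K * K => z.1 != 0) (a, b) a0.

Lemma scale_neq0 z : scale_part z != 0. Proof. exact: valP z. Qed.

Lemma affine_inj z w :
  scale_part z = scale_part w -> shift_part z = shift_part w -> z = w.
Proof.
rewrite /scale_part /shift_part => e1 e2; apply/val_inj.
by case: (val z) (val w) e1 e2 => [a b] [a' b'] /= -> ->.
Qed.

Fact affine_mul_subproof (z w : affine K) : scale_part z * scale_part w != 0.
Proof. by rewrite mulf_neq0 ?scale_neq0. Qed.
Fact affine_inv_subproof (z : affine K) : (scale_part z)^-1 != 0.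
Proof. by rewrite invr_eq0 scale_neq0. Qed.

Definition affine_one : affine K := mk_affine 0 (oner_neq0 K).
Definition affine_mul (z w : affine K) : affine K :=
  mk_affine (scale_part z * shift_part w + shift_part z) (affine_mul_subproof z w).
Definition affine_inv (z : affine K) : affine K :=
  mk_affine (- (scale_part z)^-1 * shift_part z) (affine_inv_subproof z).

Let scale_mulE z w : scale_part (affine_mul z w) = scale_part z * scale_part w.
Proof. by []. Qed.
Let shift_mulE z w : shift_part (affine_mul z w) =
  scale_part z * shift_part w + shift_part z.
Proof. by []. Qed.

Fact affine_mulA : associative affine_mul.
Proof.
by move=> x y z; apply: affine_inj; rewrite ?(scale_mulE, shift_mulE); ring.
Qed.
Fact affine_mul1 : left_id affine_one affine_mul.
Proof.
by move=> x; apply: affine_inj; rewrite ?(scale_mulE, shift_mulE) mul1r ?addr0.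
Qed.
Fact affine_mulr1 : right_id affine_one affine_mul.
Proof.
move=> x; apply: affine_inj; rewrite ?(scale_mulE, shift_mulE) ?mulr1 //.
by rewrite mulr0 add0r.
Qed.
Fact affine_mulV : left_inverse affine_one affine_inv affine_mul.
Proof.
move=> x; apply: affine_inj; rewrite ?(scale_mulE, shift_mulE).
  by rewrite /= mulVf ?scale_neq0.
by rewrite -[X in _ + X]/(- (scale_part x)^-1 * shift_part x) mulNr subrr.
Qed.
Fact affine_mulrV : right_inverse affine_one affine_inv affine_mul.
Proof.
move=> x; apply: affine_inj; rewrite ?(scale_mulE, shift_mulE).
  by rewrite /= mulfV ?scale_neq0.
rewrite -[X in _ * X]/(- (scale_part x)^-1 * shift_part x).
by rewrite mulrA mulrN mulfV ?scale_neq0 // mulN1r addNr.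
Qed.
HB.instance Definition _ := isGroup.Build (affine K)
  affine_mulA affine_mul1 affine_mulr1 affine_mulV affine_mulrV.

Lemma scale_partM (z w : affine K) :
  scale_part (z * w)%g = scale_part z * scale_part w.
Proof. by []. Qed.
Lemma shift_partM (z w : affine K) :
  shift_part (z * w)%g = scale_part z * shift_part w + shift_part z.
Proof. by []. Qed.
Lemma scale_part1 : scale_part 1%g = 1. Proof. by []. Qed.
Lemma shift_part1 : shift_part 1%g = 0. Proof. by []. Qed.
Lemma scale_partV (z : affine K) : scale_part z^-1%g = (scale_part z)^-1.
Proof. by []. Qed.
Lemma shift_partV (z : affine K) :
  shift_part z^-1%g = - (scale_part z)^-1 * shift_part z.
Proof. by []. Qed.
Lemma scale_partX (z : affine K) n : scale_part (z ^+ n)%g = scale_part z ^+ n.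
Proof. by elim: n => // n IHn; rewrite expgS exprS scale_partM IHn. Qed.
Lemma shift_partX (z : affine K) n :
  shift_part (z ^+ n)%g = shift_part z * \sum_(i < n) scale_part z ^+ i.
Proof.
elim: n => [|n IHn]; first by rewrite big_ord0 mulr0.
rewrite expgS shift_partM IHn big_ord_recl expr0.
under [in RHS]eq_bigr do rewrite exprS.
by rewrite -mulr_sumr; ring.
Qed.

Definition fixes (P : K) (z : affine K) : Prop :=
  scale_part z * P + shift_part z = P.

Lemma fixes_commute P z w : fixes P z -> fixes P w -> commute z w.
Proof.
move=> zP wP; apply: affine_inj; rewrite ?scale_partM ?shift_partM 1?mulrC //.
have Ez : shift_part z = P - scale_part z * P by rewrite -[X in X - _]zP; ring.
have Ew : shift_part w = P - scale_part w * P by rewrite -[X in X - _]wP; ring.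
by rewrite Ez Ew; ring.
Qed.

Lemma fixes_uniq P Q z : scale_part z != 1 -> fixes P z -> fixes Q z -> P = Q.
Proof.
move=> z1 zP zQ; have : (scale_part z - 1) * (P - Q) = 0.
  transitivity ((scale_part z * P + shift_part z) - P
    - ((scale_part z * Q + shift_part z) - Q)); first by ring.
  by rewrite zP zQ !subrr.
by move=> /eqP; rewrite mulf_eq0 !subr_eq0 (negPf z1) => /eqP.
Qed.

Lemma fixes_mul P z w : fixes (scale_part w * P + shift_part w) z ->
  fixes P w -> fixes P (z * w)%g.
Proof.
by rewrite /fixes scale_partM shift_partM => + wP; rewrite wP => zP;
   rewrite -[RHS]zP -[in RHS]wP; ring.
Qed.

Lemma fixesM P z w : fixes P z -> fixes P w -> fixes P (z * w)%g.
Proof. by move=> zP wP; apply: fixes_mul => //; rewrite wP. Qed.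

Lemma fixesV P z : fixes P z -> fixes P z^-1%g.
Proof.
move=> zP; rewrite /fixes scale_partV /shift_part /= -/(shift_part z).
rewrite -[X in _ * X + _]zP; field; exact: scale_neq0.
Qed.

Lemma fixes1 P : fixes P 1%g.
Proof. by rewrite /fixes scale_part1 shift_part1 mul1r addr0. Qed.

(** The relation says that [w^-1 z w = u] fixes [P], so [z] fixes [w P]; but
[P] is its only fixed point. *)
Lemma fixes_conj P z w u : scale_part z != 1 -> fixes P z -> fixes P u ->
  (z * w = w * u)%g -> fixes P w.
Proof.
move=> z1 zP uP E; apply: (fixes_uniq z1 _ zP).
have := congr1 scale_part E; have := congr1 shift_part E.
rewrite !scale_partM !shift_partM /fixes => e2 e1.
rewrite mulrDr mulrA -addrA e2 e1 -[X in _ = _ * X + _]uP; ring.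
Qed.

Lemma commute_fixes P z w :
  scale_part z != 1 -> fixes P z -> commute z w -> fixes P w.
Proof. by move=> z1 zP; apply: fixes_conj. Qed.

Lemma exists_fixed z : scale_part z != 1 -> exists P, fixes P z.
Proof.
move=> z1; exists (shift_part z / (1 - scale_part z)); rewrite /fixes.
by field; rewrite subr_eq0 eq_sym.
Qed.

End AffineGroup.

(** * Exponents and affine representations *)
Lemma relations_same p k (H : groupType) (A C S : H) :
  commute C (A ^+ p) -> commute C S -> relations p k A A C S.
Proof. by move=> CA CS; split; rewrite // mulgV mul1g. Qed.

Lemma expg_conj (H : groupType) (x y : H) n :
  (x * y * x^-1) ^+ n = x * y ^+ n * x^-1.
Proof.
elim: n => [|n IHn]; first by rewrite mulg1 mulgV.
by rewrite !expgS IHn !mulgA mulgVK.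
Qed.

Section MarkedHom.
Variables (p k : nat) (G : groupType) (M : marking p k G).

Section Universal.
Variables (H : groupType) (A B C S : H) (r : relations p k A B C S).

Definition marked_hom : G -> H := sval (cid (marking_hom M r)).

Lemma marked_homM : {morph marked_hom : x y / x * y}.
Proof. exact: (svalP (cid (marking_hom M r))).1. Qed.

Lemma marked_hom_gen : [/\ marked_hom (al M) = A, marked_hom (be M) = B,
  marked_hom (cc M) = C & marked_hom (ss M) = S].
Proof. exact: (svalP (cid (marking_hom M r))).2. Qed.

End Universal.

Fact commute_additive (V : zmodType) (x y : addgroup V) : commute x y.
Proof. exact: addrC. Qed.

Definition exponent_hom (i l m : addgroup int) : G -> addgroup int :=
  marked_hom (relations_same (p := p) k (commute_additive l (i ^+ p))
                (commute_additive l m)).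

(** The three coordinates of the abelianization, in which [al] and [be] agree.
*)
Definition exp_al : G -> int := exponent_hom 1%R 0%R 0%R.
Definition exp_cc : G -> int := exponent_hom 0%R 1%R 0%R.
Definition exp_ss : G -> int := exponent_hom 0%R 0%R 1%R.

Lemma exp_alM x y : exp_al (x * y) = (exp_al x + exp_al y)%R.
Proof. exact: (@marked_homM (addgroup int)). Qed.
Lemma exp_ccM x y : exp_cc (x * y) = (exp_cc x + exp_cc y)%R.
Proof. exact: (@marked_homM (addgroup int)). Qed.
Lemma exp_ssM x y : exp_ss (x * y) = (exp_ss x + exp_ss y)%R.
Proof. exact: (@marked_homM (addgroup int)). Qed.

Lemma exp_al_gen : [/\ exp_al (al M) = 1%R, exp_al (be M) = 1%R,
  exp_al (cc M) = 0%R & exp_al (ss M) = 0%R].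
Proof. exact: (@marked_hom_gen (addgroup int)). Qed.
Lemma exp_cc_gen : [/\ exp_cc (al M) = 0%R, exp_cc (be M) = 0%R,
  exp_cc (cc M) = 1%R & exp_cc (ss M) = 0%R].
Proof. exact: (@marked_hom_gen (addgroup int)). Qed.
Lemma exp_ss_gen : [/\ exp_ss (al M) = 0%R, exp_ss (be M) = 0%R,
  exp_ss (cc M) = 0%R & exp_ss (ss M) = 1%R].
Proof. exact: (@marked_hom_gen (addgroup int)). Qed.

Section AdditiveMap.
Variables (V : zmodType) (chi : G -> V).
Hypothesis chiM : forall x y, chi (x * y) = (chi x + chi y)%R.

Lemma addmap1 : chi 1 = 0%R.
Proof. exact: (hom1 (H := addgroup V) chiM). Qed.
Lemma addmapV x : chi x^-1 = (- chi x)%R.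
Proof. exact: (homV (H := addgroup V) chiM). Qed.
Lemma addmapX x n : chi (x ^+ n) = (chi x *+ n)%R.
Proof. by elim: n => [|n IHn]; rewrite ?addmap1 // expgS chiM IHn mulrS. Qed.

End AdditiveMap.

(** [chi] takes the same value on [al] and [be], since [al^p = be^p]. *)
Lemma exponentsE (chi : G -> int) (p_gt0 : 0 < p) :
  (forall x y, chi (x * y) = (chi x + chi y)%R) -> forall g,
  chi g = (chi (al M) * exp_al g + chi (cc M) * exp_cc g
           + chi (ss M) * exp_ss g)%R.
Proof.
move=> chiM.
have [a1 a2 a3 a4] := exp_al_gen; have [c1 c2 c3 c4] := exp_cc_gen.
have [s1 s2 s3 s4] := exp_ss_gen.
have Eb : chi (be M) = chi (al M).
  have [AB _ _] := marking_rel M; have := congr1 chi AB; rewrite !addmapX //.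
  by move=> /eqP; rewrite eqr_pMn2r // => /eqP.
elim/(marking_ind M).
- rewrite !addmap1 //; first by ring. 
  1,2,3: by [exact: exp_alM | exact: exp_ccM | exact: exp_ssM].
- by move=> x y hx hy; rewrite chiM exp_alM exp_ccM exp_ssM hx hy; ring.
- move=> x hx; rewrite (addmapV chiM) (addmapV exp_alM) (addmapV exp_ccM).
  by rewrite (addmapV exp_ssM) hx; ring.
- by rewrite a1 c1 s1; ring.
- by rewrite Eb a2 c2 s2; ring.
- by rewrite a3 c3 s3; ring.
- by rewrite a4 c4 s4; ring.
Qed.

Lemma marking_abelian (H : groupType) (f : G -> H) :
  {morph f : x y / x * y} ->
  commute (f (al M)) (f (be M)) -> commute (f (al M)) (f (cc M)) ->
  commute (f (al M)) (f (ss M)) -> commute (f (be M)) (f (cc M)) ->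
  commute (f (be M)) (f (ss M)) -> commute (f (cc M)) (f (ss M)) ->
  forall x y, commute (f x) (f y).
Proof.
move=> fM ab ac as_ bc bs cs.
have central z : commute z (f (al M)) -> commute z (f (be M)) ->
    commute z (f (cc M)) -> commute z (f (ss M)) -> forall y, commute z (f y).
  move=> za zb zc zs; elim/(marking_ind M) => //.
  - by rewrite (hom1 fM); apply: commute1.
  - by move=> x y zx zy; rewrite fM; apply: commuteM.
  - by move=> x zx; rewrite (homV fM); apply: commuteV.
have Csym (z w : H) : commute z w -> commute w z by apply: commute_sym.
have Crefl (z : H) : commute z z by apply: commute_refl.
move=> x; apply: (central); apply: (Csym); apply: (central); auto.
Qed.

End MarkedHom.

(** Nonabelian images of a marked group in a group of affine maps: the
generators cannot have a common fixed point. *)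
Section AffineImages.
Variables (p k : nat) (p_gt0 : 0 < p) (G : groupType) (M : marking p k G).
Variable K : numFieldType.
Variables (f : G -> affine K) (fM : {morph f : x y / x * y}).
Hypothesis nab : ~ forall x y, commute (f x) (f y).

Let A := f (al M). Let B := f (be M). Let C := f (cc M). Let S := f (ss M).

Let rel : relations p k A B C S. Proof. exact: relations_hom (marking_rel M). Qed.

Let no_common_fixpoint P :
  fixes P A -> fixes P B -> fixes P C -> fixes P S -> False.
Proof.
move=> PA PB PC PS; apply: nab.
suff Pf g : fixes P (f g) by move=> x y; apply: fixes_commute.
elim/(marking_ind M): g => // [|x y Px Py|x Px].
- by rewrite (hom1 fM); apply: fixes1.
- by rewrite fM; apply: fixesM.
- by rewrite (homV fM); apply: fixesV.
Qed.

(** With positive scales, [1 + a + ... + a^(p-1)] is not zero, and the shift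
of [z] can be recovered from the one of its power. *)
Lemma affine_pos_root_uniq (z w : affine K) :
  (0 < scale_part z)%R -> (0 < scale_part w)%R -> z ^+ p = w ^+ p -> z = w.
Proof.
move=> z0 w0 E.
have E1 : scale_part z = scale_part w.
  have := congr1 (@scale_part K) E; rewrite !scale_partX => /eqP.
  by rewrite eqrXn2 ?ltW // => /eqP.
apply: affine_inj => //.
have := congr1 (@shift_part K) E; rewrite !shift_partX E1 => /mulIf; apply.
rewrite gt_eqF //; case: p p_gt0 => // n _; rewrite big_ord_recl expr0.
by rewrite ltr_pwDl ?ltr01 // sumr_ge0 // => i _; rewrite exprn_ge0 // ltW.
Qed.

(** Uniqueness of roots makes the images of [al] and [be] equal, and the image
[C] of [c] commute with them, hence with the image of [s] as well. If [C] were
not a translation, its fixed point would be common to all. *)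
Lemma affine_pos_scale_cc :
  (forall g, 0 < scale_part (f g))%R -> scale_part C = 1%R.
Proof.
move=> pos; have [AB CA CS] := rel.
have EAB : A = B by apply: affine_pos_root_uniq; rewrite ?pos.
have CA1 : commute C A.
  suff E : C * A * C^-1 = A by rewrite /commute -{2}E mulgVK.
  apply: affine_pos_root_uniq; rewrite ?pos //.
    by rewrite -(homV fM) -!fM pos.
  by rewrite expg_conj CA mulgK.
have CS1 : commute C S by rewrite /commute CS -EAB mulgV mul1g.
apply/eqP/negPn/negP => C1; have [P PC] := exists_fixed C1.
apply: (@no_common_fixpoint P) => //.
- exact: commute_fixes C1 PC CA1.
- by rewrite -EAB; apply: commute_fixes C1 PC CA1.
- exact: commute_fixes C1 PC CS1.
Qed.

(** If [A^p] were not a translation, its fixed point [P] would be fixed by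
everything that commutes with [A^p], namely [A], [B] and [C], and then by [S]
through [fixes_conj]. *)
Lemma affine_scale_al : scale_part C != 1%R -> (scale_part A ^+ p = 1)%R.
Proof.
move=> C1; have [AB CA CS] := rel; rewrite -scale_partX.
apply/eqP/negPn/negP => A1; have [P PAp] := exists_fixed A1.
have PA : fixes P A by apply: commute_fixes A1 PAp _; apply/commute_sym/commuteX.
have PB : fixes P B.
  apply: commute_fixes A1 PAp _; rewrite AB; apply/commute_sym/commuteX.
  exact: commute_refl.
have PC : fixes P C by apply: commute_fixes A1 PAp _; apply/commute_sym.
apply: (@no_common_fixpoint P) => //; apply: (fixes_conj C1 PC _ CS).
have fixesX z n : fixes P z -> fixes P (z ^+ n).
  move=> Pz; elim: n => [|n IHn]; first exact: fixes1.
  by rewrite expgS; apply: fixesM.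
exact: fixesM (fixesM (fixesX _ k PA) (fixesV (fixesX _ k PB))) PC.
Qed.

End AffineImages.

Lemma exprz2_eq1 (n : int) : (2%:R ^ n = 1 :> algC)%R -> n = 0%R.
Proof.
have E (m : nat) : (2%:R ^+ m = 1 :> algC)%R -> m = 0%N.
  rewrite -natrX => /eqP; rewrite (eqr_nat _ _ 1) => /eqP/(congr1 (logn 2)).
  by rewrite pfactorK.
case: n => m; first by rewrite -exprnP => /E ->.
by rewrite NegzE -exprnN => /eqP; rewrite invr_eq1 => /eqP/E.
Qed.

Lemma primitive_root_neq0 (K : fieldType) p (z : K) :
  0 < p -> (p.-primitive_root z)%R -> (z != 0)%R.
Proof.
move=> p_gt0 zp; apply/eqP => z0; have := prim_expr_order zp.
by rewrite z0 expr0n gtn_eqF // => /eqP; rewrite eq_sym oner_eq0.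
Qed.

Lemma commute1g (H : groupType) (x : H) : commute 1 x.
Proof. exact/commute_sym/commute1. Qed.

Section AffineMarking.
Variables (p k : nat) (G : groupType) (M : marking p k G).
Variables (K : fieldType) (A C S : affine K).
Hypotheses (CA : commute C (A ^+ p)) (CS : commute C S).

Definition affine_hom : G -> affine K := marked_hom M (relations_same k CA CS).

Lemma affine_hom_scale g : (scale_part (affine_hom g) =
  scale_part A ^ exp_al M g * scale_part C ^ exp_cc M g
  * scale_part S ^ exp_ss M g)%R.
Proof.
have fM : {morph affine_hom : x y / x * y} by exact: marked_homM.
have [fa fb fc fs] := marked_hom_gen M (relations_same k CA CS).
have [a1 a2 a3 a4] := exp_al_gen M; have [c1 c2 c3 c4] := exp_cc_gen M.
have [s1 s2 s3 s4] := exp_ss_gen M.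
have A0 := scale_neq0 A; have C0 := scale_neq0 C; have S0 := scale_neq0 S.
elim/(marking_ind M): g => [|x y hx hy|x hx||||].
- rewrite (addmap1 (exp_alM M)) (addmap1 (exp_ccM M)) (addmap1 (exp_ssM M)).
  by rewrite (hom1 fM) !expr0z !mulr1.
- rewrite exp_alM exp_ccM exp_ssM fM scale_partM hx hy !expfzDr //; ring.
- rewrite (addmapV (exp_alM M)) (addmapV (exp_ccM M)) (addmapV (exp_ssM M)).
  by rewrite (homV fM) scale_partV hx !invfM !invr_expz.
- by rewrite a1 c1 s1 !expr0z !mulr1 expr1z -fa.
- by rewrite a2 c2 s2 !expr0z !mulr1 expr1z -fb.
- by rewrite a3 c3 s3 !expr0z mulr1 mul1r expr1z -fc.
- by rewrite a4 c4 s4 !expr0z !mul1r expr1z -fs.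
Qed.

End AffineMarking.

Section SurjectionExponents.
Variables (p k k' : nat) (p_gt1 : 1 < p) (G G' : groupType).
Variables (M : marking p k G) (M' : marking p k' G').
Variables (f : G -> G') (fM : {morph f : x y / x * y}).
Hypothesis f_surj : forall y, exists x, f x = y.

Lemma surj_nonabelian (H : groupType) (g : G' -> H) u v :
  ~ commute (g u) (g v) -> ~ forall x y, commute ((g \o f) x) ((g \o f) y).
Proof.
move=> uv h; apply: uv; have [x <-] := f_surj u; have [y <-] := f_surj v.
exact: h.
Qed.

Let p_gt0 : 0 < p. Proof. exact: ltnW. Qed.

Local Notation aff a b a0 := (@mk_affine algC a%R b%R a0).

Let two0 : (2%:R != 0 :> algC)%R. Proof. by rewrite pnatr_eq0. Qed.
Let one0 : (1 != 0 :> algC)%R. Proof. exact: oner_neq0. Qed.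

Let noncomm (K : fieldType) (z w : affine K) :
  (scale_part z * shift_part w + shift_part z !=
   scale_part w * shift_part z + shift_part w)%R -> ~ commute z w.
Proof. by move=> /eqP zw /(congr1 (@shift_part K)). Qed.

Let pos_scale_cc (A S : affine algC) :
  ~ commute A S -> (0 < scale_part A)%R -> (0 < scale_part S)%R ->
  (scale_part A ^ exp_al M' (f (cc M)) * scale_part S ^ exp_ss M' (f (cc M))
    = 1)%R.
Proof.
move=> AS A0 S0.
pose g := affine_hom M' (commute1g (A ^+ p)) (commute1g S).
have gM : {morph g : x y / x * y} by exact: marked_homM.
have [ga gb gc gs] : [/\ g (al M') = A, g (be M') = A, g (cc M') = 1 & g (ss M') = S].
  exact: marked_hom_gen.
have nab : ~ forall x y, commute ((g \o f) x) ((g \o f) y).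
  by apply: (@surj_nonabelian _ _ (al M') (ss M')); rewrite ga gs.
have := affine_pos_scale_cc p_gt0 M (hom_comp fM gM) nab.
rewrite /= affine_hom_scale scale_part1 exp1rz mulr1; apply=> x.
by rewrite affine_hom_scale scale_part1 exp1rz mulr1 mulr_gt0 ?exprz_gt0.
Qed.

(** Two representations in which [c] is trivial and all scales are powers of
2: the first one sends [al] to [2 t] and [s] to [t + 1], the second one [al]
to [t + 1] and [s] to [2 t]. *)
Lemma exp_image_cc : exp_al M' (f (cc M)) = 0%R /\ exp_ss M' (f (cc M)) = 0%R.
Proof.
split; apply: exprz2_eq1.
  have /= := @pos_scale_cc (aff 2%:R 0 two0) (aff 1 1 one0).
  rewrite exp1rz mulr1; apply; rewrite ?ltr01 ?ltr0n //.
  apply: noncomm; rewrite /= mulr1 mulr0 !addr0 add0r.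
  by rewrite (eqr_nat _ 2 1).
have /= := @pos_scale_cc (aff 1 1 one0) (aff 2%:R 0 two0).
rewrite exp1rz mul1r; apply; rewrite ?ltr01 ?ltr0n //.
apply: noncomm; rewrite /= mulr0 add0r mulr1 addr0.
by rewrite (eqr_nat _ 1 2).
Qed.

Let scale_al (C S : affine algC) (z : algC) : (p.-primitive_root z)%R ->
  commute C S -> shift_part C != 0%R -> scale_part C != 1%R ->
  (scale_part C ^ exp_cc M' (f (cc M)) != 1)%R ->
  (0 < scale_part C)%R -> (0 < scale_part S)%R ->
  (scale_part C ^ exp_cc M' (f (al M)) * scale_part S ^ exp_ss M' (f (al M))
    = 1)%R.
Proof.
move=> zp CS C2 C1 Cc C0 S0.
have z0 := primitive_root_neq0 p_gt0 zp.
pose A := mk_affine 0%R z0.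
have Ap : A ^+ p = 1.
  apply: affine_inj; rewrite ?scale_partX ?shift_partX ?mul0r //.
  by rewrite (prim_expr_order zp).
have CA : commute C (A ^+ p) by rewrite Ap; apply: commute1.
pose g := affine_hom M' CA CS.
have gM : {morph g : x y / x * y} by exact: marked_homM.
have [ga gb gc gs] : [/\ g (al M') = A, g (be M') = A, g (cc M') = C & g (ss M') = S].
  exact: marked_hom_gen.
have z1 : z != 1%R.
  by rewrite -[z]expr1 -(prim_order_dvd zp) gtnNdvd.
have nab : ~ forall x y, commute ((g \o f) x) ((g \o f) y).
  apply: (@surj_nonabelian _ _ (al M') (cc M')); rewrite ga gc.
  apply: noncomm; rewrite /= mulr0 add0r addr0 -[X in _ != X]mul1r.
  by rewrite (inj_eq (mulIf C2)).
have := affine_scale_al (M := M) (hom_comp fM gM) nab.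
rewrite /= !affine_hom_scale exp_image_cc.1 exp_image_cc.2 !expr0z.
rewrite mulr1 mul1r => /(_ Cc).
have zi (i : int) : ((scale_part A ^ i) ^+ p = 1)%R.
  by rewrite exprnP exprz_exp mulrC -exprz_exp -exprnP (prim_expr_order zp) exp1rz.
rewrite -mulrA exprMn zi mul1r => /eqP.
rewrite pexpr_eq1 // ?mulr_ge0 ?exprz_ge0 ?(ltW C0) ?(ltW S0) //.
by move/eqP.
Qed.

(** Here [al] is a rotation of order [p] around 0 and [c] is [2 t + 1], of
fixed point -1. With [s] trivial, the exponent of [c] in [f al] must vanish;
with [s] equal to [c], so must the sum of the exponents of [c] and [s]. *)
Lemma exp_image_al : exp_cc M' (f (cc M)) != 0%R ->
  exp_cc M' (f (al M)) = 0%R /\ exp_ss M' (f (al M)) = 0%R.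
Proof.
move=> l0; have [z zp] := C_prim_root_exists p_gt0.
pose C := aff 2%:R 1 two0.
have Cc : (scale_part C ^ exp_cc M' (f (cc M)) != 1)%R.
  by apply: contraNneq l0 => /exprz2_eq1 ->.
have C1 : scale_part C != 1%R by rewrite (eqr_nat _ 2 1).
have l1 : exp_cc M' (f (al M)) = 0%R.
  have := scale_al zp (commute1 C) one0 C1 Cc.
  rewrite scale_part1 exp1rz mulr1 => h; apply: exprz2_eq1; apply: h;
    by rewrite ?ltr01 ?ltr0n.
split=> //; have := scale_al zp (commute_refl C) one0 C1 Cc.
rewrite l1 expr0z mul1r => h; apply: exprz2_eq1; apply: h;
  by rewrite ?ltr01 ?ltr0n.
Qed.

End SurjectionExponents.

Lemma intz_mul_eq1 (a b : int) : (a * b = 1)%R -> a = 1%R \/ a = (-1)%R.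
Proof.
move=> ab; have /eqP : absz (a * b)%R = 1%N by rewrite ab.
by rewrite abszM muln_eq1 => /andP[/eqP a1 _]; lia.
Qed.

Section IsomorphismExponents.
Variables (p k k' : nat) (p_gt1 : 1 < p) (G G' : groupType).
Variables (M : marking p k G) (M' : marking p k' G').
Variables (f : G -> G') (f' : G' -> G) (fM : {morph f : x y / x * y}).
Hypotheses (fK : cancel f f') (f'K : cancel f' f).

Let f'M : {morph f' : x y / x * y}.
Proof. by move=> x y; apply: (can_inj fK); rewrite fM !f'K. Qed.

Let f_surj y : exists x, f x = y. Proof. by exists (f' y). Qed.
Let f'_surj y : exists x, f' x = y. Proof. by exists (f y). Qed.
Let p_gt0 : 0 < p. Proof. exact: ltnW. Qed.

Lemma iso_exponentsE (chi : G' -> int) : (forall x y, chi (x * y) = (chi x + chi y)%R) ->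
  forall g, chi g = (chi (f (al M)) * exp_al M (f' g)
    + chi (f (cc M)) * exp_cc M (f' g) + chi (f (ss M)) * exp_ss M (f' g))%R.
Proof.
move=> chiM g; rewrite -[in LHS](f'K g).
by apply: (exponentsE M (chi := chi \o f)) => // x y; rewrite /= fM chiM.
Qed.

(** Expand the exponent of [c] along [f' cc], whose other exponents are zero.
*)
Lemma exp_iso_cc :
  (exp_cc M' (f (cc M)) * exp_cc M (f' (cc M')) = 1)%R.
Proof.
have [i0 m0] := exp_image_cc p_gt1 M' M f'M f'_surj.
have := iso_exponentsE (exp_ccM M') (cc M'); rewrite i0 m0 !mulr0 add0r addr0 => <-.
by have [] := exp_cc_gen M'.
Qed.

Lemma exp_iso_al_cc : exp_cc M' (f (al M)) = 0%R /\ exp_ss M' (f (al M)) = 0%R.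
Proof.
apply: (exp_image_al p_gt1 fM f_surj); apply/eqP => l0.
by have := exp_iso_cc; rewrite l0 mul0r.
Qed.

End IsomorphismExponents.

Lemma exp_iso_units p k k' (p_gt1 : 1 < p) (G G' : groupType)
    (M : marking p k G) (M' : marking p k' G') (f : G -> G') (f' : G' -> G) :
  {morph f : x y / x * y} -> cancel f f' -> cancel f' f ->
  [/\ exp_al M' (f (al M)) = 1%R \/ exp_al M' (f (al M)) = (-1)%R,
      exp_cc M' (f (cc M)) = 1%R \/ exp_cc M' (f (cc M)) = (-1)%R
    & exp_ss M' (f (ss M)) = 1%R \/ exp_ss M' (f (ss M)) = (-1)%R].
Proof.
move=> fM fK f'K.
have f'M : {morph f' : x y / x * y}.
  by move=> x y; apply: (can_inj fK); rewrite fM !f'K.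
have f_surj y : exists x, f x = y by exists (f' y).
have [l0 m0] := exp_iso_al_cc p_gt1 M M' fM fK f'K.
have [l0' m0'] := exp_iso_al_cc p_gt1 M' M f'M f'K fK.
have [_ ms] := exp_image_cc p_gt1 M M' fM f_surj.
have expE := iso_exponentsE p_gt1 M fM f'K.
split.
- apply: (intz_mul_eq1 (b := exp_al M (f' (al M')))).
  have := expE _ (exp_alM M') (al M'); rewrite l0' m0' !mulr0 !addr0 => <-.
  by have [] := exp_al_gen M'.
- apply: intz_mul_eq1; exact: (exp_iso_cc p_gt1 M M' fM fK f'K).
- apply: (intz_mul_eq1 (b := exp_ss M (f' (ss M')))).
  have := expE _ (exp_ssM M') (ss M'); rewrite m0 ms !mul0r !add0r => <-.
  by have [] := exp_ss_gen M'.
Qed.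

(** * Roots of matrices over a polynomial ring *)
Section TwoByTwo.
Local Open Scope ring_scope.
Variable R : comNzRingType.
Implicit Types X Y Z : 'M[R]_2.

Lemma sum_ord2 (V : nmodType) (F : 'I_2 -> V) : \sum_i F i = F 0 + F 1.
Proof.
rewrite big_ord_recl big_ord1; congr (_ + F _); exact/val_inj.
Qed.

Lemma mulmx2E X Y i j : (X * Y) i j = X i 0 * Y 0 j + X i 1 * Y 1 j.
Proof. by rewrite mxE sum_ord2. Qed.

Lemma matrix2P X Y : X 0 0 = Y 0 0 -> X 0 1 = Y 0 1 -> X 1 0 = Y 1 0 ->
  X 1 1 = Y 1 1 -> X = Y.
Proof.
move=> e00 e01 e10 e11; apply/matrixP => i j.
have ord2 (m : 'I_2) : m = 0 \/ m = 1.
  by case: m => [[|[|m]] lt_m]; [left | right | ] => //; apply/val_inj.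
by case: (ord2 i) => ->; case: (ord2 j) => ->.
Qed.

Lemma trace2E X : \tr X = X 0 0 + X 1 1.
Proof. by rewrite /mxtrace sum_ord2. Qed.

Lemma det2E X : \det X = X 0 0 * X 1 1 - X 0 1 * X 1 0.
Proof.
rewrite (expand_det_row _ 0) sum_ord2 /cofactor !det_mx11 !mxE /=.
rewrite expr0 expr1 mul1r mulN1r mulrN; congr (_ * X _ _ - _ * X _ _);
  exact/val_inj.
Qed.

Lemma cayley_hamilton2 X : X * X = \tr X *: X - (\det X)%:M.
Proof.
by apply: matrix2P; rewrite mulmx2E trace2E det2E !mxE /= ?mulr1n ?mulr0n; ring.
Qed.

Lemma trace_expSS X n :
  \tr (X ^+ n.+2) = \tr X * \tr (X ^+ n.+1) - \det X * \tr (X ^+ n).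
Proof.
rewrite !exprS mulrA cayley_hamilton2 mulrBl raddfB /=; congr (_ - _).
  by rewrite -scalerAl mxtraceZ.
by rewrite -mulmxE mul_scalar_mx mxtraceZ.
Qed.

End TwoByTwo.

Section Commutant.
Local Open Scope ring_scope.
Variable R : idomainType.

(** To a matrix [V] attach the vector with entries [V 0 1], [V 1 0] and [V 1 1
- V 0 0]. Two matrices commute if and only if their vectors are parallel, and
parallelism to a nonzero vector is transitive; the vector of [Z] is zero
exactly when [Z] is scalar. *)
Lemma nonscalar_commutant2 (X Y Z : 'M[R]_2) : X * Z = Z * X -> Y * Z = Z * Y ->
  X * Y = Y * X \/ Z = (Z 0 0)%:M.
Proof.
move=> XZ YZ.
have eqs (V : 'M[R]_2) : V * Z = Z * V ->
    [/\ V 0 1 * Z 1 0 - Z 0 1 * V 1 0 = 0,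
        V 0 1 * (Z 1 1 - Z 0 0) - Z 0 1 * (V 1 1 - V 0 0) = 0
      & V 1 0 * (Z 1 1 - Z 0 0) - Z 1 0 * (V 1 1 - V 0 0) = 0].
  move=> VZ; have E i j : (V * Z) i j - (Z * V) i j = 0 by rewrite VZ subrr.
  have := E 0 0; have := E 0 1; have := E 1 0; rewrite !mulmx2E => e10 e01 e00.
  split.
  - by rewrite -[RHS]e00; ring.
  - by rewrite -[RHS]e01; ring.
  - by rewrite -[RHS]oppr0 -[in RHS]e10; ring.
have [x1 x2 x3] := eqs _ XZ; have [y1 y2 y3] := eqs _ YZ.
set a := X 0 1 in x1 x2 *; set b := X 1 0 in x1 x3 *.
set c := X 1 1 - X 0 0 in x2 x3 *.
set a' := Y 0 1 in y1 y2 *; set b' := Y 1 0 in y1 y3 *.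
set c' := Y 1 1 - Y 0 0 in y2 y3 *.
set u := Z 0 1 in x1 x2 y1 y2 *; set v := Z 1 0 in x1 x3 y1 y3 *.
set w := Z 1 1 - Z 0 0 in x2 x3 y2 y3 *.
suff [[ab ac bc]|[u0 v0 w0]] : [/\ a * b' - a' * b = 0, a * c' - a' * c = 0
      & b * c' - b' * c = 0] \/ [/\ u = 0, v = 0 & w = 0].
- left; apply/eqP; rewrite -subr_eq0; apply/eqP.
  apply: matrix2P; rewrite !mxE !sum_ord2 -/a -/b -/a' -/b'.
  + by rewrite -[RHS]ab; ring.
  + by rewrite -[RHS]ac /c /c'; ring.
  + by rewrite -[RHS]oppr0 -[in RHS]bc /c /c'; ring.
  + by rewrite -[RHS]oppr0 -[in RHS]ab; ring.
- right; apply: matrix2P; rewrite !mxE //= ?mulr1n ?mulr0n //.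
  by apply/eqP; rewrite -subr_eq0 -/w w0.
have cancel (t e : R) : t != 0 -> t * e = 0 -> e = 0.
  by move=> t0 te; apply: (mulfI t0); rewrite te mulr0.
have [u0|u0] := eqVneq u 0; last first.
  left; split; apply: (cancel u) => //.
  - transitivity (a' * (a * v - u * b) - a * (a' * v - u * b')); first by ring.
    by rewrite x1 y1 !mulr0 subrr.
  - transitivity (a' * (a * w - u * c) - a * (a' * w - u * c')); first by ring.
    by rewrite x2 y2 !mulr0 subrr.
  - transitivity (b' * (a * w - u * c) - b * (a' * w - u * c')
       + w * (a' * b - a * b')); first by ring.
    have -> : a' * b - a * b' = 0.
      apply: (cancel u) => //.
      transitivity (a * (a' * v - u * b') - a' * (a * v - u * b)); first by ring.
      by rewrite x1 y1 !mulr0 subrr.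
    by rewrite x2 y2 !mulr0 subrr addr0.
have [v0|v0] := eqVneq v 0; last first.
  left; split; apply: (cancel v) => //.
  - transitivity (b' * (a * v - u * b) - b * (a' * v - u * b')); first by ring.
    by rewrite x1 y1 !mulr0 subrr.
  - have ab : a * b' - a' * b = 0.
      apply: (cancel v) => //.
      transitivity (b' * (a * v - u * b) - b * (a' * v - u * b')); first by ring.
      by rewrite x1 y1 !mulr0 subrr.
    transitivity (a' * (b * w - v * c) - a * (b' * w - v * c')
       + w * (a * b' - a' * b)); first by ring.
    by rewrite x3 y3 ab !mulr0 subrr addr0.
  - transitivity (b' * (b * w - v * c) - b * (b' * w - v * c')); first by ring.
    by rewrite x3 y3 !mulr0 subrr.
have [w0|w0] := eqVneq w 0; first by right.
rewrite u0 v0 !mul0r !subr0 in x1 x2 x3 y1 y2 y3.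
have E (t : R) : t * w = 0 -> t = 0.
  by move=> /eqP; rewrite mulf_eq0 (negPf w0) orbF => /eqP.
rewrite (E a) // (E b) // (E a') // (E b') //.
by left; rewrite !mul0r subrr.
Qed.

End Commutant.

Section Bitriangular.
Local Open Scope ring_scope.
Variable K : fieldType.
Implicit Types X Y : 'M[{poly K}]_2.

(** Lower triangular at 0 with diagonal [1, a], upper triangular at 1 with
first diagonal entry [c], and of constant determinant [a]. *)
Definition bitri (a c : K) X : Prop :=
  [/\ (X 0 1).[0] = 0, (X 0 0).[0] = 1, (X 1 0).[1] = 0, (X 0 0).[1] = c
    & \det X = a%:P].

Lemma bitri1 : bitri 1 1 1.
Proof. by rewrite /bitri !mxE /= ?mulr1n ?mulr0n !hornerE det1. Qed.

Lemma bitri_diag a c X : bitri a c X -> (X 1 1).[0] = a /\ c * (X 1 1).[1] = a.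
Proof.
move=> [x01 x00 x10 xc]; rewrite det2E => dX; split.
  by have := congr1 (horner^~ 0) dX; rewrite !hornerE x01 x00 mul1r mul0r subr0.
by have := congr1 (horner^~ 1) dX; rewrite !hornerE x10 xc mulr0 subr0.
Qed.

Lemma bitriM a b c d X Y : bitri a c X -> bitri b d Y -> bitri (a * b) (c * d) (X * Y).
Proof.
move=> [x01 x00 x10 xc dX] [y01 y00 y10 yd dY].
rewrite /bitri !mulmx2E det_mulmx dX dY polyCM !hornerE.
by rewrite x01 x00 x10 xc y01 y00 y10 yd; split=> //; ring.
Qed.

Lemma bitriV a c X Y : a != 0 -> X * Y = 1 -> bitri a c X -> bitri a^-1 c^-1 Y.
Proof.
move=> a0 XY hX; have [x11 xcc] := bitri_diag hX.
have [x01 x00 x10 xc dX] := hX.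
have E i j t : (X i 0).[t] * (Y 0 j).[t] + (X i 1).[t] * (Y 1 j).[t]
    = ((1 : 'M[{poly K}]_2) i j).[t] by rewrite -XY mulmx2E !hornerE.
have c0 : c != 0 by apply: contra_eq_neq xcc => ->; rewrite mul0r eq_sym.
have x1 : (X 1 1).[1] != 0.
  by apply: contra_eq_neq xcc => ->; rewrite mulr0 eq_sym.
have := E 0 0 0; have := E 0 1 0; have := E 1 0 1; have := E 0 0 1.
rewrite !mxE /= ?mulr1n ?mulr0n !hornerE x01 x00 x10 xc !mul0r !mul1r !addr0.
rewrite add0r => e3 e2 e1 e0.
have y10 : (Y 1 0).[1] = 0.
  by move/eqP: e2; rewrite mulf_eq0 (negPf x1) => /eqP.
split=> //; first by apply: (mulfI c0); move: e3; rewrite mulfV // y10 mulr0 addr0.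
have := congr1 determinant XY; rewrite det_mulmx dX det1 => dXY.
have a1 : a%:P != 0 by rewrite polyC_eq0.
by apply: (mulfI a1); rewrite dXY -polyCM divff.
Qed.

Lemma bitriX a c X n : bitri a c X -> bitri (a ^+ n) (c ^+ n) (X ^+ n).
Proof.
by move=> hX; elim: n => [|n IHn]; [exact: bitri1 | rewrite !exprS; apply: bitriM].
Qed.

(** By the recursion [trace_expSS], the degrees of the traces of the powers of
[X] increase strictly if the trace of [X] is not constant; but the trace of
[X^n = 1] is 2. *)
Lemma root_unity_trace_const X a n : \det X = a%:P -> (0 < n)%N -> X ^+ n = 1 ->
  (size (\tr X) <= 1)%N.
Proof.
move=> dX n_gt0 Xn; rewrite leqNgt; apply/negP => tX.
have grow m : (size (\tr (X ^+ m)) < size (\tr (X ^+ m.+1)))%N.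
  elim: m => [|m IHm].
    rewrite expr0 expr1 mxtrace1; apply: leq_trans tX.
    by rewrite ltnS -[_%:R]/(2%:R) -polyC_natr size_polyC_leq1.
  rewrite trace_expSS dX; have t1 : \tr (X ^+ m.+1) != 0.
    by rewrite -size_poly_gt0; apply: leq_ltn_trans IHm.
  have tX0 : \tr X != 0 by rewrite -size_poly_gt0; apply: ltnW.
  have sM : (size (\tr (X ^+ m.+1)) < size (\tr X * \tr (X ^+ m.+1))%R)%N.
    rewrite size_mul //; case: (size (\tr X)) tX => [|[|s]] // _.
    by rewrite !addSn /= ltnS leq_addl.
  rewrite size_polyDl // size_polyN mul_polyC.
  by apply: leq_ltn_trans (size_scale_leq _ _) _; apply: ltn_trans sM.
have big m : (0 < m)%N -> (1 < size (\tr (X ^+ m)))%N.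
  case: m => // m _; elim: m => [|m IHm]; first by rewrite expr1.
  exact: ltn_trans (grow _).
have := big n n_gt0; rewrite Xn mxtrace1 -polyC_natr ltnNge.
by rewrite size_polyC_leq1.
Qed.

(** The trace is [1 + a] at 0 and [c + a / c] at 1; if they agree, then [(1 -
c) (1 - a / c) = 0]. *)
Lemma bitri_root_unity a c X n : (0 < n)%N -> X ^+ n = 1 -> bitri a c X ->
  c = 1 \/ c = a.
Proof.
move=> n_gt0 Xn hX; have [x11 xcc] := bitri_diag hX.
have [x01 x00 x10 xc dX] := hX.
have /size1_polyC tX := root_unity_trace_const dX n_gt0 Xn.
have : (\tr X).[0] = (\tr X).[1] by rewrite tX !hornerC.
rewrite trace2E !hornerE x00 x11 xc -xcc => E.
have : (1 - c) * (1 - (X 1 1).[1]) = 0.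
  transitivity ((1 + c * (X 1 1).[1]) - (c + (X 1 1).[1])); first by ring.
  by rewrite E subrr.
move=> /eqP; rewrite mulf_eq0 !subr_eq0 => /orP[]/eqP <-; first by left.
by right; rewrite mulr1.
Qed.

(** If [Z = X^n] is not scalar, then [X] and [Y] commute with it, hence with
each other, and [X^-1 Y] is a root of unity of determinant 1. If [Z] is
scalar, its entry at 0 and its determinant show that it is 1, so that [X] and
[Y] are roots of unity themselves. *)
Lemma bitri_roots a c d X Y n : (0 < n)%N -> a != 0 -> X ^+ n = Y ^+ n ->
  bitri a c X -> bitri a d Y ->
  c = d \/ (c = 1 \/ c = a) /\ (d = 1 \/ d = a).
Proof.
move=> n_gt0 a0 XY hX hY; pose Z := X ^+ n.
have XZ : X * Z = Z * X by rewrite /Z -exprS -exprSr.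
have YZ : Y * Z = Z * Y by rewrite /Z XY -exprS -exprSr.
have [XYc|Zs] := nonscalar_commutant2 XZ YZ; last first.
  right; suff Z1 : Z = 1.
    split; first exact: bitri_root_unity n_gt0 Z1 hX.
    by apply: bitri_root_unity n_gt0 _ hY; rewrite -XY.
  have [_ z00 _ _ dZ] := bitriX n hX.
  rewrite -/Z in z00 dZ; rewrite Zs; rewrite Zs det_scalar in dZ.
  have an : a ^+ n = 1.
    by have := congr1 (horner^~ 0) dZ; rewrite !hornerE z00 expr1n => <-.
  have : (Z 0 0 - 1) * (Z 0 0 + 1) = 0.
    by rewrite -subr_sqr dZ an polyC1 expr1n subrr.
  move=> /eqP; rewrite mulf_eq0 subr_eq0 addr_eq0 => /orP[/eqP->//|/eqP z1].
  have := z00; rewrite z1 !hornerE => m1; congr (_%:M).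
  by rewrite -polyC1 -polyCN m1.
have Xu : X \is a GRing.unit.
  rewrite unitmxE; have [_ _ _ _ ->] := hX.
  by rewrite poly_unitE size_polyC a0 coefC unitfE.
have hV : bitri a^-1 c^-1 X^-1 by apply: bitriV a0 _ hX; apply: divrr.
have hW := bitriM hV hY; rewrite mulVf // in hW.
have Wn : (X^-1 * Y) ^+ n = 1.
  rewrite exprMn_comm; last by apply/commr_sym/commrV/commr_sym.
  by rewrite exprVn XY mulVr // -XY unitrX.
have [E|E] := bitri_root_unity n_gt0 Wn hW; left;
  have [_ xcc] := bitri_diag hX;
  have c0 : c != 0 by [apply: contra_eq_neq xcc => ->; rewrite mul0r eq_sym];
  by rewrite -[c]mulr1 -E mulVKf.
Qed.

Lemma one_idem_mul (V : algType {poly K}) (E : V) (u v : {poly K}) :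
  E * E = E -> (1 + (u - 1) *: E) * (1 + (v - 1) *: E) = 1 + (u * v - 1) *: E.
Proof.
move=> EE; rewrite mulrDl mul1r mulrDr mulr1 -scalerAl -scalerAr EE scalerA.
by rewrite -!addrA -!scalerDl; congr (1 + _ *: E); ring.
Qed.

Variables (z : K) (p : nat) (zp : p.-primitive_root z).

Definition idemA : 'M[{poly K}]_2 :=
  \matrix_(i, j) ((i == 1) && (j == 1))%:R.
(** A family of projections of rank 1 that joins a lower triangular one, at 0,
to an upper triangular one, at 1, exchanging the two diagonal entries. *)
Definition idemB : 'M[{poly K}]_2 :=
  \matrix_(i, j) (if i == 0 then 'X else 1 - 'X).

Definition rotA : 'M[{poly K}]_2 := 1 + (z%:P - 1) *: idemA.
Definition rotB : 'M[{poly K}]_2 := 1 + (z%:P - 1) *: idemB.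

Lemma idemA_idem : idemA * idemA = idemA.
Proof. by apply: matrix2P; rewrite mulmx2E !mxE /=; ring. Qed.
Lemma idemB_idem : idemB * idemB = idemB.
Proof. by apply: matrix2P; rewrite mulmx2E !mxE /=; ring. Qed.

Lemma rot_expE (E : 'M[{poly K}]_2) n : E * E = E ->
  (1 + (z%:P - 1) *: E) ^+ n = 1 + ((z ^+ n)%:P - 1) *: E.
Proof.
move=> EE; elim: n => [|n IHn]; first by rewrite subrr scale0r addr0.
by rewrite exprS IHn one_idem_mul // -polyCM -exprS.
Qed.

Lemma rotAp : rotA ^+ p = 1.
Proof.
by rewrite rot_expE ?idemA_idem // (prim_expr_order zp) subrr scale0r addr0.
Qed.
Lemma rotBp : rotB ^+ p = 1.
Proof.
by rewrite rot_expE ?idemB_idem // (prim_expr_order zp) subrr scale0r addr0.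
Qed.

Lemma rotA_bitri : bitri z 1 rotA.
Proof.
have dA : \det rotA = z%:P by rewrite det2E !mxE /= ?mulr1n ?mulr0n; ring.
by rewrite /bitri dA !mxE /= ?mulr1n ?mulr0n !hornerE.
Qed.

Lemma rotB_bitri : bitri z z rotB.
Proof.
have dB : \det rotB = z%:P by rewrite det2E !mxE /= ?mulr1n ?mulr0n; ring.
rewrite /bitri dB !mxE /= ?mulr1n ?mulr0n !hornerE; split=> //.
  by rewrite subrr mulr0.
by rewrite -[LHS]/(1 + z - 1) addrAC subrr add0r.
Qed.

End Bitriangular.

(** * A representation in a wreath product *)
Definition zfun (D : groupType) : Type := int -> D.

Section FunctionGroup.
Variable D : groupType.

Let zfun_ext (u v : zfun D) : (forall i, u i = v i) -> u = v.
Proof. exact: functional_extensionality_dep. Qed.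

Definition zfun_one : zfun D := fun=> 1.
Definition zfun_mul (u v : zfun D) : zfun D := fun i => u i * v i.
Definition zfun_inv (u : zfun D) : zfun D := fun i => (u i)^-1.

Fact zfun_mulA : associative zfun_mul.
Proof. by move=> u v w; apply: zfun_ext => i; apply: mulgA. Qed.
Fact zfun_mul1 : left_id zfun_one zfun_mul.
Proof. by move=> u; apply: zfun_ext => i; apply: mul1g. Qed.
Fact zfun_mulr1 : right_id zfun_one zfun_mul.
Proof. by move=> u; apply: zfun_ext => i; apply: mulg1. Qed.
Fact zfun_mulV : left_inverse zfun_one zfun_inv zfun_mul.
Proof. by move=> u; apply: zfun_ext => i; apply: mulVg. Qed.
Fact zfun_mulrV : right_inverse zfun_one zfun_inv zfun_mul.
Proof. by move=> u; apply: zfun_ext => i; apply: mulgV. Qed.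

HB.instance Definition _ := Choice.copy (zfun D) (int -> D).
HB.instance Definition _ := isGroup.Build (zfun D)
  zfun_mulA zfun_mul1 zfun_mulr1 zfun_mulV zfun_mulrV.

Lemma zfunM (u v : zfun D) i : (u * v) i = u i * v i. Proof. by []. Qed.
Lemma zfunV (u : zfun D) i : u^-1 i = (u i)^-1. Proof. by []. Qed.
Lemma zfun1 i : (1 : zfun D) i = 1. Proof. by []. Qed.

Definition translate (j : int) (u : zfun D) : zfun D := fun i => u (i - j)%R.

Fact translate0 u : translate 0%R u = u.
Proof. by apply: zfun_ext => i; rewrite /translate subr0. Qed.
Fact translateD i j u : translate (i + j)%R u = translate i (translate j u).
Proof. by apply: zfun_ext => n; rewrite /translate opprD addrA. Qed.
Fact translateM i u v : translate i (u * v) = translate i u * translate i v.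
Proof. by []. Qed.

Definition translation : zaction (zfun D) :=
  ZAction translate0 translateD translateM.

Definition wreath : groupType := sdprodZ translation.

Definition wreath_elt (u : zfun D) (n : int) : wreath := (u, n).

Lemma wreath_eltM u m v n : wreath_elt u m * wreath_elt v n = wreath_elt (u * translate m v) (m + n)%R.
Proof. by []. Qed.

Definition only_at0 (x : D) : zfun D := fun i => if i == 0%R then x else 1.
Definition from1 (x : D) : zfun D := fun i => if (1 <= i)%R then x else 1.

Lemma wreath_eltX u n : wreath_elt u 0%R ^+ n = wreath_elt (fun i => u i ^+ n) 0%R.
Proof.
elim: n => // n IHn; rewrite expgS IHn wreath_eltM addr0 translate0.
by congr wreath_elt; apply: zfun_ext => i; rewrite expgS.
Qed.

Lemma wreath_eltV u : (wreath_elt u 0%R)^-1 = wreath_elt u^-1 0%R.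
Proof.
by apply/mulg1_eq; rewrite wreath_eltM addr0 translate0 mulgV.
Qed.

(** The stable letter translates the coordinates by 1. As [c s = s al^k be^-k
c], the coordinates of [c] are constant but for a jump by [x^k y^-k] between 0
and 1. They are trivial at 0, where they have to commute with [x^p]. *)
Lemma wreath_relations p k (x y : D) : x ^+ p = y ^+ p ->
  relations p k (wreath_elt (only_at0 x) 0%R) (wreath_elt (only_at0 y) 0%R)
    (wreath_elt (from1 (x ^+ k * y ^- k)) 0%R) (wreath_elt 1 1%R).
Proof.
move=> xy; split.
- rewrite !wreath_eltX; congr wreath_elt; apply: zfun_ext => i; rewrite /only_at0.
  by case: eqP => // _; rewrite !expg1n.
- rewrite !wreath_eltX /commute !wreath_eltM translate0 !addr0; congr wreath_elt.
  apply: zfun_ext => i; rewrite translate0 !zfunM /only_at0 /from1.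
  by case: eqP => [->|_]; rewrite ?expg1n ?mul1g ?mulg1.
- rewrite !wreath_eltX wreath_eltV [LHS]wreath_eltM [X in _ * (X * _)]wreath_eltM.
  rewrite [X in _ = _ * X]wreath_eltM [RHS]wreath_eltM !translate0.
  rewrite !addr0 add0r mul1g; congr wreath_elt.
  apply: zfun_ext => i; rewrite [RHS]/translate !zfunM zfunV /only_at0 /from1 /=.
  rewrite zfun1 mulg1.
  have [->|i1] := eqVneq i 1%R; first by rewrite subrr eqxx lexx mulg1.
  rewrite subr_eq0 (negPf i1) !expg1n invg1 !mul1g.
  by congr (if _ then _ else _); lia.
Qed.

Section WreathHom.
Variables (p k : nat) (G : groupType) (M : marking p k G).
Variables (x y : D) (xy : x ^+ p = y ^+ p).

Definition wreath_hom : G -> wreath := marked_hom M (wreath_relations k xy).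

Lemma wreath_homM : {morph wreath_hom : g h / g * h}.
Proof. exact: marked_homM. Qed.

Definition wcoord (g : G) (i : int) : D := (wreath_hom g).1 i.

Lemma wreath_hom_ss g : (wreath_hom g).2 = exp_ss M g.
Proof.
have [a b c s] := marked_hom_gen M (wreath_relations k xy).
rewrite -!/(wreath_hom _) in a b c s.
have [s1 s2 s3 s4] := exp_ss_gen M.
elim/(marking_ind M): g => [|g h hg hh|g hg||||].
- by rewrite (hom1 wreath_homM) (addmap1 (exp_ssM M)).
- by rewrite wreath_homM exp_ssM -hg -hh.
- by rewrite (homV wreath_homM) (addmapV (exp_ssM M)) -hg.
- by rewrite a s1.
- by rewrite b s2.
- by rewrite c s3.
- by rewrite s s4.
Qed.

Lemma wcoordM g h i : wcoord (g * h) i = wcoord g i * wcoord h (i - exp_ss M g)%R.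
Proof. by rewrite /wcoord wreath_homM -wreath_hom_ss. Qed.

Lemma wcoord1 i : wcoord 1 i = 1.
Proof. by rewrite /wcoord (hom1 wreath_homM). Qed.

Lemma wcoordV g i : wcoord g^-1 i = (wcoord g (i + exp_ss M g)%R)^-1.
Proof.
apply/esym/mulg1_eq; have := wcoordM g g^-1 (i + exp_ss M g)%R.
by rewrite mulgV wcoord1 addrK => <-.
Qed.

Lemma wcoordX g n i : exp_ss M g = 0%R -> wcoord (g ^+ n) i = wcoord g i ^+ n.
Proof.
move=> g0; elim: n => [|n IHn]; first by rewrite wcoord1.
by rewrite !expgS wcoordM g0 subr0 IHn.
Qed.

Lemma wcoord_gen : [/\ wcoord (al M) = only_at0 x, wcoord (be M) = only_at0 y,
  wcoord (cc M) = from1 (x ^+ k * y ^- k) & wcoord (ss M) = (1 : zfun D)].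
Proof.
have [a b c s] := marked_hom_gen M (wreath_relations k xy).
rewrite -!/(wreath_hom _) in a b c s.
by split; apply: zfun_ext => i; rewrite /wcoord ?a ?b ?c ?s.
Qed.

End WreathHom.
End FunctionGroup.

(** * Degrees as Laurent polynomials *)
Section LaurentPolynomials.
Local Open Scope ring_scope.

(** A list of pairs [(m, e)] stands for the Laurent polynomial with terms [m
X^e]. *)
Definition laurent_coef (l : seq (int * int)) (i : int) : int :=
  \sum_(z <- l) (if z.2 == i then z.1 else 0).

Definition laurent_eval (l : seq (int * int)) (x : algC) : algC :=
  \sum_(z <- l) z.1%:~R * x ^ z.2.

(** After multiplication by a power of [X], this is a complex polynomial whose
only root is 0. *)
Lemma laurent_monomial (l : seq (int * int)) :
  (forall x, x != 0 -> laurent_eval l x != 0) ->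
  exists j, forall i, laurent_coef l i = if i == j then \sum_(z <- l) z.1 else 0.
Proof.
move=> noroot.
have [N N_ge] : exists N : nat, forall z, z \in l -> 0 <= z.2 + N%:Z.
  exists (\sum_(z <- l) absz z.2)%N => z zl.
  have : (absz z.2 <= \sum_(z <- l) absz z.2)%N by rewrite (big_rem z) //= leq_addr.
  by set N := (\sum_(z <- l) _)%N; lia.
pose P : {poly algC} := \sum_(z <- l) z.1%:~R *: 'X^(absz (z.2 + N%:Z)).
have P_eval x : x != 0 -> P.[x] = x ^+ N * laurent_eval l x.
  move=> x0; rewrite horner_sum mulr_sumr !big_seq; apply: eq_bigr => z zl.
  rewrite hornerZ hornerXn mulrCA; congr (_ * _).
  case En: (z.2 + N%:Z) (N_ge z zl) => [n|//] _.
  by rewrite /= exprnP -En addrC expfzDr.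
have P_coef n : P`_n = (laurent_coef l (n%:Z - N%:Z))%:~R.
  rewrite coef_sum /laurent_coef rmorph_sum /= !big_seq; apply: eq_bigr => z zl.
  rewrite coefZ coefXn; have := N_ge z zl => zN.
  have -> : (n == absz (z.2 + N%:Z)) = (z.2 == n%:Z - N%:Z) by lia.
  by case: eqP; rewrite ?mulr1 ?mulr0.
have P0 : P != 0.
  apply: contraNneq (noroot 1 (oner_neq0 _)) => P0.
  by have := P_eval 1 (oner_neq0 _); rewrite P0 horner0 expr1n mul1r => <-.
have [r Pr] := closed_field_poly_normal P.
have r0 x : x \in r -> x = 0.
  move=> xr; apply/eqP/negPn/negP => x0.
  have : root P x by rewrite Pr rootZ ?lead_coef_eq0 // root_prod_XsubC.
  rewrite rootE P_eval // mulf_eq0 expf_eq0 (negPf x0) andbF /=.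
  by apply/negP/noroot.
have {}Pr : P = lead_coef P *: 'X^(size r).
  rewrite {1}Pr; congr (_ *: _); rewrite big_seq.
  rewrite (eq_bigr (fun=> 'X)) => [|x /r0 ->]; last by rewrite subr0.
  by rewrite -big_seq big_const_seq count_predT -Monoid.iteropE.
have Esum : (\sum_(z <- l) z.1)%:~R = lead_coef P.
  have := P_eval 1 (oner_neq0 _); rewrite {1}Pr hornerZ hornerXn !expr1n mulr1 => ->.
  by rewrite mul1r rmorph_sum; apply: eq_bigr => z _; rewrite exp1rz mulr1.
exists ((size r)%:Z - N%:Z) => i.
have [iN|iN] := leP 0 (i + N%:Z); last first.
  rewrite ifF; last by apply/negP => /eqP; lia.
  by rewrite /laurent_coef big_seq big1 // => z /N_ge zN; case: eqP => // zi; rewrite zi leNgt iN in zN.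
have Ei : i = (absz (i + N%:Z))%:Z - N%:Z by lia.
apply: (@intr_inj algC); rewrite {1}Ei -P_coef Pr coefZ coefXn.
have -> : (absz (i + N%:Z) == size r) = (i == (size r)%:Z - N%:Z) by lia.
by rewrite fun_if Esum; case: eqP; rewrite ?mulr1 ?mulr0.
Qed.

End LaurentPolynomials.

Section Degrees.
Variables (p k : nat) (G : groupType) (M : marking p k G).

(** The sum of the exponents of [al] and [be], refined by the position of the
stable letter: it records each factor at the coordinate given by the exponent
of [s] before it. *)
Definition degree (g : G) (i : int) : int :=
  wcoord M (erefl ((1%R : addgroup int) ^+ p)) g i.

Lemma degreeM g h i :
  degree (g * h) i = (degree g i + degree h (i - exp_ss M g))%R.
Proof. exact: (@wcoordM (addgroup int)). Qed.

Lemma degree1 i : degree 1 i = 0%R. Proof. exact: (@wcoord1 (addgroup int)). Qed.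

Lemma degreeV g i : degree g^-1 i = (- degree g (i + exp_ss M g))%R.
Proof. exact: (@wcoordV (addgroup int)). Qed.

Lemma degree_gen : [/\ forall i, degree (al M) i = (i == 0%R)%:R%R,
  forall i, degree (be M) i = (i == 0%R)%:R%R,
  forall i, degree (cc M) i = 0%R & forall i, degree (ss M) i = 0%R].
Proof.
have [a b c s] := wcoord_gen M (erefl ((1%R : addgroup int) ^+ p)).
split=> i; rewrite /degree ?a ?b ?c ?s /only_at0 /from1 //; try by case: eqP.
by rewrite mulgV; case: ifP.
Qed.

Section Base.
Variables (x : algC) (x0 : (x != 0)%R).
Let A : affine algC := mk_affine 1%R (oner_neq0 _).
Let S : affine algC := mk_affine 0%R x0.

(** [al] and [be] become the translation by 1, and [s] the multiplication by
[x]; the shift of an image is the value at [x] of the degree, seen as a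
Laurent polynomial. *)
Definition eval_hom : G -> affine algC :=
  affine_hom M (commute1g (A ^+ p)) (commute1g S).

Lemma eval_homM : {morph eval_hom : g h / g * h}.
Proof. exact: marked_homM. Qed.

Lemma eval_hom_gen : [/\ eval_hom (al M) = A, eval_hom (be M) = A,
  eval_hom (cc M) = 1 & eval_hom (ss M) = S].
Proof. exact: marked_hom_gen. Qed.

Lemma eval_hom_scale g : scale_part (eval_hom g) = (x ^ exp_ss M g)%R.
Proof.
by rewrite affine_hom_scale /= -[scale_part 1]/(1%R) !exp1rz !mul1r.
Qed.

End Base.

Definition laurent_expansion (g : G) (l : seq (int * int)) : Prop :=
  [/\ forall i, degree g i = laurent_coef l i,
      exp_al M g = (\sum_(z <- l) z.1)%R
    & forall x (x0 : (x != 0)%R), shift_part (eval_hom x0 g) = laurent_eval l x].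

Lemma exists_laurent_expansion g : exists l, laurent_expansion g l.
Proof.
have [da db dc ds] := degree_gen; have [ea eb ec es] := exp_al_gen M.
have gens1 (h : G) : (forall i, degree h i = (i == 0%R)%:R%R) ->
    exp_al M h = 1%R ->
    (forall x (x0 : (x != 0)%R), shift_part (eval_hom x0 h) = 1%R) ->
    exists l, laurent_expansion h l.
  move=> d1 e1 s1; exists [:: (1%R, 0%R)]; split.
  - by move=> i; rewrite d1 /laurent_coef big_seq1 /= eq_sym; case: eqP.
  - by rewrite big_seq1.
  - by move=> x x0; rewrite s1 /laurent_eval big_seq1 /= expr0z mulr1.
have gens0 (h : G) : (forall i, degree h i = 0%R) ->
    exp_al M h = 0%R ->
    (forall x (x0 : (x != 0)%R), shift_part (eval_hom x0 h) = 0%R) ->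
    exists l, laurent_expansion h l.
  move=> d1 e1 s1; exists [::]; split.
  - by move=> i; rewrite d1 /laurent_coef big_nil.
  - by rewrite big_nil.
  - by move=> x x0; rewrite s1 /laurent_eval big_nil.
elim/(marking_ind M): g => [|g h [l [lc ls le]] [l' [lc' ls' le']]|g [l [lc ls le]]||||].
- apply: gens0 => [i||x x0]; first exact: degree1.
    exact: (addmap1 (exp_alM M)).
  by rewrite (hom1 (eval_homM x0)).
- exists (l ++ [seq (z.1, z.2 + exp_ss M g)%R | z <- l']); split.
  + move=> i; rewrite degreeM lc lc' /laurent_coef big_cat big_map /=.
    by congr (_ + _)%R; apply: eq_bigr => z _; rewrite [_ == (_ - _)%R]eq_sym subr_eq eq_sym.
  + by rewrite exp_alM ls ls' big_cat big_map.
  + move=> x x0; rewrite (eval_homM x0) shift_partM le le' eval_hom_scale.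
    rewrite addrC /laurent_eval big_cat big_map /= mulr_sumr; congr (_ + _)%R.
    by apply: eq_bigr => z _; rewrite expfzDr //; ring.
- exists [seq (- z.1, z.2 - exp_ss M g)%R | z <- l]; split.
  + move=> i; rewrite degreeV lc /laurent_coef big_map -sumrN.
    by apply: eq_bigr => z _ /=; rewrite subr_eq; case: ifP; rewrite ?oppr0.
  + by rewrite (addmapV (exp_alM M)) ls big_map -sumrN.
  + move=> x x0; rewrite (homV (eval_homM x0)).
    rewrite shift_partV eval_hom_scale le /laurent_eval big_map mulr_sumr.
    apply: eq_bigr => z _ /=; rewrite expfzDr // invr_expz rmorphN /=; ring.
- by apply: gens1 => // x x0; have [-> _ _ _] := eval_hom_gen x0.
- by apply: gens1 => // x x0; have [_ -> _ _] := eval_hom_gen x0.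
- by apply: gens0 => // x x0; have [_ _ -> _] := eval_hom_gen x0.
- by apply: gens0 => // x x0; have [_ _ _ ->] := eval_hom_gen x0.
Qed.

End Degrees.

(** * The jump of the second generator *)
Lemma degreeX p k (G : groupType) (M : marking p k G) g n i :
  exp_ss M g = 0%R -> degree M (g ^+ n) i = (degree M g i *+ n)%R.
Proof.
move=> g0; elim: n => [|n IHn]; first by rewrite degree1.
by rewrite expgS degreeM g0 subr0 IHn mulrS.
Qed.

Section RotationCharacter.
Variables (p k : nat) (p_gt0 : 0 < p) (G : groupType) (M : marking p k G).
Variables (z : algC) (zp : (p.-primitive_root z)%R).

Let z_neq0 : (z != 0)%R. Proof. exact: primitive_root_neq0 zp. Qed.

Let unit_root (X : 'M[{poly algC}]_2) : (X ^+ p = 1)%R -> X \is a GRing.unit.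
Proof. by move=> Xp; rewrite -(unitrX_pos _ p_gt0) Xp unitr1. Qed.

Definition rotA_unit : units 'M[{poly algC}]_2 :=
  exist (fun X => X \is a GRing.unit) (rotA z) (unit_root (rotAp zp)).
Definition rotB_unit : units 'M[{poly algC}]_2 :=
  exist (fun X => X \is a GRing.unit) (rotB z) (unit_root (rotBp zp)).

Fact rot_units_exp : rotA_unit ^+ p = rotB_unit ^+ p.
Proof. by apply/val_inj; rewrite !val_unitsX /= (rotAp zp) (rotBp zp). Qed.

Definition rot (g : G) (i : int) : units 'M[{poly algC}]_2 :=
  wcoord M rot_units_exp g i.

Definition bitri_units (a c : algC) (X : units 'M[{poly algC}]_2) : Prop :=
  bitri a c (val X).

Lemma bitri_unitsM a b c d X Y : bitri_units a c X -> bitri_units b d Y ->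
  bitri_units (a * b)%R (c * d)%R (X * Y).
Proof. exact: bitriM. Qed.

Lemma bitri_unitsV a c X : (a != 0)%R -> bitri_units a c X ->
  bitri_units a^-1%R c^-1%R X^-1.
Proof. by move=> a0; apply: bitriV a0 _; apply: divrr; apply: valP. Qed.

Lemma bitri_unitsX a c X n : bitri_units a c X ->
  bitri_units (a ^+ n)%R (c ^+ n)%R (X ^+ n).
Proof. by rewrite /bitri_units val_unitsX; apply: bitriX. Qed.

Lemma bitri_units1 : bitri_units 1%R 1%R 1.
Proof. exact: bitri1. Qed.

(** The first diagonal entry at 1. It is multiplicative on bitriangular
matrices, trivial on [rotA] and equal to [z] on [rotB]. *)
Definition chi (g : G) (i : int) : algC := ((val (rot g i)) 0%R 0%R).[1%R]%R.

Lemma bitri_chi g i a c : bitri_units a c (rot g i) -> c = chi g i.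
Proof. by case. Qed.

Lemma rot_gen : [/\ rot (al M) = only_at0 rotA_unit, rot (be M) = only_at0 rotB_unit,
  rot (cc M) = from1 (rotA_unit ^+ k * rotB_unit ^- k)
  & rot (ss M) = (1 : zfun (units 'M[{poly algC}]_2))].
Proof. exact: wcoord_gen. Qed.

Let bitri_theta : bitri_units 1%R (z ^- k)%R (rotA_unit ^+ k * rotB_unit ^- k).
Proof.
have hA : bitri_units z 1%R rotA_unit by exact: rotA_bitri.
have hB : bitri_units z z rotB_unit by exact: rotB_bitri.
have zk0 : (z ^+ k != 0)%R by rewrite expf_neq0.
have := bitri_unitsM (bitri_unitsX k hA) (bitri_unitsV zk0 (bitri_unitsX k hB)).
by rewrite expr1n mul1r mulfV.
Qed.

Lemma rot_bitri g i : bitri_units (z ^ degree M g i)%R (chi g i) (rot g i).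
Proof.
suff [c hc] : exists c, bitri_units (z ^ degree M g i)%R c (rot g i).
  by rewrite -(bitri_chi hc).
have [da db dc ds] := degree_gen M; have [ra rb rc rs] := rot_gen.
elim/(marking_ind M): g i => [|g h IHg IHh|g IHg||||] i.
- exists 1%R; rewrite degree1 expr0z /rot wcoord1; exact: bitri_units1.
- have [c hc] := IHg i; have [d hd] := IHh (i - exp_ss M g)%R.
  exists (c * d)%R; rewrite degreeM expfzDr // /rot wcoordM.
  exact: bitri_unitsM.
- have [c hc] := IHg (i + exp_ss M g)%R; exists c^-1%R.
  by rewrite degreeV -invr_expz /rot wcoordV; apply: bitri_unitsV; rewrite ?expfz_neq0.
- rewrite da ra /only_at0; case: eqP => _; last by exists 1%R; exact: bitri_units1.
  by exists 1%R; exact: rotA_bitri.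
- rewrite db rb /only_at0; case: eqP => _; last by exists 1%R; exact: bitri_units1.
  by exists z; exact: rotB_bitri.
- rewrite dc rc /from1 expr0z; case: ifP => _; last by exists 1%R; exact: bitri_units1.
  by exists (z ^- k)%R.
- by rewrite ds rs expr0z; exists 1%R; exact: bitri_units1.
Qed.

Lemma chiM g h i : chi (g * h) i = (chi g i * chi h (i - exp_ss M g))%R.
Proof.
apply/esym; apply: bitri_chi; rewrite /rot wcoordM.
exact: bitri_unitsM (rot_bitri g i) (rot_bitri h _).
Qed.

Lemma chiV g i : chi g^-1 i = (chi g (i + exp_ss M g))^-1%R.
Proof.
apply/esym; apply: bitri_chi; rewrite /rot wcoordV.
by apply: bitri_unitsV (rot_bitri g _); rewrite expfz_neq0.
Qed.

Lemma chi1 i : chi 1 i = 1%R.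
Proof. by apply/esym; apply: bitri_chi; rewrite /rot wcoord1; exact: bitri_units1. Qed.

Lemma chi_neq0 g i : (chi g i != 0)%R.
Proof.
have := chi1 i; rewrite -(mulgV g) chiM => E.
by apply/eqP => c0; move/eqP: E; rewrite c0 mul0r eq_sym oner_eq0.
Qed.

Lemma chiX g n i : exp_ss M g = 0%R -> chi (g ^+ n) i = (chi g i ^+ n)%R.
Proof.
move=> g0; elim: n => [|n IHn]; first by rewrite chi1.
by rewrite !expgS exprS chiM g0 subr0 IHn.
Qed.

(** The coordinates of [al], [be] and [s] are trivial away from 0; only [c]
contributes at the right end. *)
Lemma chi_ends g : exists N : int, forall i,
  ((i <= - N)%R -> chi g i = 1%R) /\
  ((N <= i)%R -> chi g i = ((z ^- k) ^ exp_cc M g)%R).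
Proof.
have zk0 : (z ^- k != 0)%R by rewrite invr_eq0 expf_neq0.
have [ea eb ec es] := exp_cc_gen M; have [ra rb rc rs] := rot_gen.
have triv h : exp_cc M h = 0%R -> (forall i, i != 0%R -> rot h i = 1) ->
    exists N : int, forall i, ((i <= - N)%R -> chi h i = 1%R) /\
      ((N <= i)%R -> chi h i = ((z ^- k) ^ exp_cc M h)%R).
  move=> h0 h1; exists 1%R => i; rewrite h0 expr0z.
  have E : i != 0%R -> chi h i = 1%R.
    by move=> i0; apply/esym; apply: bitri_chi; rewrite h1 //; exact: bitri_units1.
  by split=> hi; apply: E; lia.
elim/(marking_ind M): g => [|g h [N1 h1] [N2 h2]|g [N hN]||||].
- by apply: triv => [|i _]; [exact: (addmap1 (exp_ccM M)) | rewrite /rot wcoord1].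
- exists (`|N1| + `|N2| + `|exp_ss M g|)%R => i.
  have [h1l h1r] := h1 i; have [h2l h2r] := h2 (i - exp_ss M g)%R.
  split=> hi; rewrite chiM.
    by rewrite h1l ?h2l ?mulr1 //; lia.
  by rewrite h1r ?h2r ?exp_ccM ?expfzDr //; lia.
- exists (`|N| + `|exp_ss M g|)%R => i.
  have [hl hr] := hN (i + exp_ss M g)%R.
  split=> hi; rewrite chiV.
    by rewrite hl ?invr1 //; lia.
  by rewrite hr ?(addmapV (exp_ccM M)) ?invr_expz //; lia.
- by apply: triv => // i i0; rewrite ra /only_at0 (negPf i0).
- by apply: triv => // i i0; rewrite rb /only_at0 (negPf i0).
- exists 1%R => i; rewrite ec expr1z; split=> hi; apply/esym; apply: bitri_chi;
    rewrite rc /from1.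
    by rewrite ifF; [exact: bitri_units1 | lia].
  by rewrite ifT //; exact: bitri_theta.
- by apply: triv => // i i0; rewrite rs.
Qed.

Lemma chi_roots g h i : exp_ss M g = 0%R -> exp_ss M h = 0%R ->
  g ^+ p = h ^+ p ->
  degree M g i = degree M h i /\
  (chi g i = chi h i \/
   let a := (z ^ degree M g i)%R in
   (chi g i = 1%R \/ chi g i = a) /\ (chi h i = 1%R \/ chi h i = a)).
Proof.
move=> g0 h0 gh.
have Ed : degree M g i = degree M h i.
  have := congr1 (degree M ^~ i) gh; rewrite !degreeX //.
  by move=> /eqP; rewrite eqr_pMn2r // => /eqP.
split=> //.
have Er : (val (rot g i) ^+ p = val (rot h i) ^+ p)%R.
  by rewrite -!val_unitsX -!(wcoordX _ _ _ _) // gh.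
apply: bitri_roots p_gt0 _ Er (rot_bitri g i) _; first by rewrite expfz_neq0.
by rewrite Ed; exact: rot_bitri.
Qed.

End RotationCharacter.

Lemma const_from (K : eqType) (C : int -> K) (a : int) (n : nat) :
  (forall i, (a <= i)%R -> C (i + 1)%R = C i) -> C (a + n%:Z)%R = C a.
Proof.
move=> h; elim: n => [|n IHn]; first by rewrite addr0.
by rewrite -addn1 PoszD addrA h ?IHn //; lia.
Qed.

(** The two ends of a sequence that jumps only once differ by the jump. *)
Lemma single_jump (K : fieldType) (C rho : int -> K) (j e : int) (lo hi : K) :
  (e = 1 \/ e = -1)%R ->
  (forall i, C i = rho (i - e) * C (i - e))%R ->
  (forall i, i != j -> rho i = 1%R) ->
  (exists N : int, forall i, ((i <= - N)%R -> C i = lo) /\ ((N <= i)%R -> C i = hi)) ->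
  (hi = rho j * lo \/ lo = rho j * hi)%R.
Proof.
move=> he hC hrho [N hN].
pose m := (`|N| + `|j| + 1)%N.
have lo_m (i : int) : (i <= - m%:Z)%R -> C i = lo.
  by move=> im; apply: (hN i).1; lia.
have hi_m (i : int) : (m%:Z <= i)%R -> C i = hi.
  by move=> im; apply: (hN i).2; lia.
case: he => Ee; rewrite Ee in hC.
- left; have S i : (C (i + 1) = rho i * C i)%R by rewrite hC addrK.
  have Cj1 : C (j + 1)%R = hi.
    have h := @const_from _ C (j + 1)%R (2 * m).
    rewrite -h => [|i ji]; first by apply: hi_m; lia.
    by rewrite S hrho ?mul1r //; lia.
  have Cj : C j = lo.
    have h := @const_from _ C (j - (2 * m)%:Z)%R.
    have h2 := @const_from _ (fun i => C (- i)%R) (- j)%R (2 * m).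
    rewrite /= opprK in h2; rewrite -h2 => [|i ji]; first by apply: lo_m; lia.
    rewrite -[RHS](_ : C (- (i + 1) + 1)%R = _); last by congr C; ring.
    by rewrite S hrho ?mul1r //; lia.
  by rewrite -Cj1 -Cj S.
- right; have S i : (C i = rho (i + 1) * C (i + 1))%R by rewrite [LHS]hC opprK.
  have Cj : C j = hi.
    have h := @const_from _ C j (2 * m).
    rewrite -h => [|i ji]; first by apply: hi_m; lia.
    by rewrite [RHS]S hrho ?mul1r //; lia.
  have Cj1 : C (j - 1)%R = lo.
    have h2 := @const_from _ (fun i => C (- i)%R) (1 - j)%R (2 * m).
    rewrite /= opprB in h2; rewrite -h2 => [|i ji]; first by apply: lo_m; lia.
    rewrite S (_ : - (i + 1) + 1 = - i)%R; last by ring.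
    by rewrite hrho ?mul1r //; lia.
  by rewrite -Cj1 -Cj S subrK.
Qed.

Section Rigidity.
Variables (p k k' : nat) (p_gt1 : 1 < p) (G G' : groupType).
Variables (M : marking p k G) (M' : marking p k' G').
Variables (f : G -> G') (f' : G' -> G) (fM : {morph f : x y / x * y}).
Hypotheses (fK : cancel f f') (f'K : cancel f' f).

Let p_gt0 : 0 < p. Proof. exact: ltnW. Qed.

Let x := f (al M). Let y := f (be M). Let c := f (cc M). Let s := f (ss M).

Let rel : relations p k x y c s. Proof. exact: relations_hom (marking_rel M). Qed.

Let ss_x : exp_ss M' x = 0%R.
Proof. by have [_] := exp_iso_al_cc p_gt1 M M' fM fK f'K. Qed.

Let ss_y : exp_ss M' y = 0%R.
Proof.
have [xy _ _] := rel; have := congr1 (exp_ss M') xy.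
rewrite !(addmapX (exp_ssM M')) ss_x mul0rn => /esym/eqP.
by rewrite mulrn_eq0 gtn_eqF //= => /eqP.
Qed.

Let f_surj u : exists v, f v = u. Proof. by exists (f' u). Qed.

Let ss_c : exp_ss M' c = 0%R.
Proof. by have [_] := exp_image_cc p_gt1 M M' fM f_surj. Qed.

(** At a root [t] of the degree of [x], the representation [eval_hom] would
kill [x], then [y] as translations have unique roots, and the images of [c]
and [s] would commute. The image would be abelian, which is impossible for [t
<> 1]; and the value at 1 is the exponent of [al] in [x]. *)
Lemma degree_image_al : exists j, forall i,
  degree M' x i = if i == j then exp_al M' x else 0%R.
Proof.
have [l [dl el evl]] := exists_laurent_expansion M' x.
have [xe _ _] := exp_iso_units p_gt1 M M' fM fK f'K.
have [t t0|j hj] := @laurent_monomial l; last first.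
  by exists j => i; rewrite dl el hj.
apply/eqP => lt.
have [t1|t1] := eqVneq t 1%R.
  have : ((exp_al M' x)%:~R = laurent_eval l 1)%R.
    rewrite el rmorph_sum /laurent_eval; apply: eq_bigr => w _.
    by rewrite exp1rz mulr1.
  rewrite t1 in lt; rewrite lt => /eqP; rewrite intr_eq0 /x.
  by case: xe => ->.
pose g := eval_hom M' t0.
have gM : {morph g : u v / u * v} by exact: eval_homM.
have [ga gb gc gs] := eval_hom_gen M' t0.
have gx : g x = 1.
  by apply: affine_inj; rewrite ?eval_hom_scale ?ss_x ?expr0z // evl.
have gy : g y = 1.
  have [xy _ cs] := rel; have gy1 : scale_part (g y) = 1%R.
    by rewrite eval_hom_scale ss_y expr0z.
  apply: affine_inj => //.
  have := congr1 (fun u => shift_part (g u)) xy; rewrite /= !(homX gM) gx expg1n.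
  rewrite shift_partX gy1; under eq_bigr do rewrite expr1n.
  rewrite sumr_const card_ord => /esym/eqP; rewrite mulf_eq0 pnatr_eq0.
  by rewrite gtn_eqF // orbF => /eqP.
have gcs : commute (g c) (g s).
  have [_ _ cs] := rel; have := congr1 g cs.
  by rewrite !gM (homV gM) !(homX gM) gx gy !expg1n invg1 !mul1g.
have ab := marking_abelian (M := M) (f := g \o f) (hom_comp fM gM).
rewrite /= -/x -/y -/c -/s gx gy in ab.
have {}ab : forall u v : G, commute (g (f u)) (g (f v)).
  by apply: ab => //; exact: commute1g.
have := ab (f' (al M')) (f' (ss M')); rewrite !f'K /g ga gs.
move=> /(congr1 (@shift_part _)); rewrite !shift_partM /shift_part /scale_part /=.
by rewrite mulr0 addr0 add0r mulr1 => /eqP; rewrite eq_sym (negPf t1).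
Qed.

Theorem marking_rigid : coprime k' p -> k = k' %[mod p] \/ p %| k + k'.
Proof.
move=> k'p; have [z zp] := C_prim_root_exists p_gt0.
have z0 := primitive_root_neq0 p_gt0 zp.
have zk0 (n : nat) : (z ^+ n != 0)%R by rewrite expf_neq0.
have [j dj] := degree_image_al.
have [he hl hm] := exp_iso_units p_gt1 M M' fM fK f'K.
rewrite -/x -/c -/s in he hl hm.
pose X := chi p_gt0 M' zp x. pose Y := chi p_gt0 M' zp y.
pose C := chi p_gt0 M' zp c.
pose rho i := ((X i / Y i) ^+ k)%R.
have [xy _ cs] := rel.
(* The relation [c s = s x^k y^-k c], read on [chi] at the coordinate [i]. *)
have hC i : (C i = rho (i - exp_ss M' s) * C (i - exp_ss M' s))%R.
  have := congr1 (fun g => chi p_gt0 M' zp g i) cs.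
  have ssX (g : G') n : exp_ss M' g = 0%R -> exp_ss M' (g ^+ n) = 0%R.
    by move=> g0; rewrite (addmapX (exp_ssM M')) g0 mul0rn.
  rewrite !chiM exp_ssM ss_c (ssX x) // subr0 mulrC => /(mulfI (chi_neq0 _ _ _ _ _)).
  rewrite chiV !chiX // (addmapV (exp_ssM M')) !ssX // oppr0 !addr0.
  by rewrite /rho expr_div_n.
have roots i := @chi_roots _ _ p_gt0 _ M' _ zp x y i ss_x ss_y xy.
(* Away from [j] the degree is 0, so the alternatives of [chi_roots] coincide. *)
have hrho i : i != j -> rho i = 1%R.
  move=> ij; have [_] := roots i; rewrite dj (negPf ij) expr0z -/(X i) -/(Y i).
  move=> E; rewrite /rho (_ : X i = Y i) ?divff ?expr1n ?chi_neq0 //.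
  by case: E => // -[[->|->] [->|->]].
have /= := single_jump hm hC hrho (chi_ends p_gt0 M' zp c).
have rho_j : [\/ rho j = 1, rho j = z ^+ k | rho j = z ^- k]%R.
  have [_] := roots j; rewrite dj eqxx -/(X j) -/(Y j) /rho => -[->|].
    by rewrite divff ?chi_neq0 // expr1n; apply: Or31.
  set a := (z ^ _)%R => /= XYa; have a0 : a != 0%R by rewrite expfz_neq0.
  have : [\/ (X j / Y j) ^+ k = 1, (X j / Y j) ^+ k = a ^+ k
            | (X j / Y j) ^+ k = a ^- k]%R.
    case: XYa => [[->|->] [->|->]].
    - by apply: Or31; rewrite divr1 expr1n.
    - by apply: Or33; rewrite mul1r exprVn.
    - by apply: Or32; rewrite divr1.
    - by apply: Or31; rewrite divff // expr1n.
  have [->|->] : a = z \/ a = z^-1%R by rewrite /a; case: he => ->; auto.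
    by [].
  by rewrite exprVn invrK => -[]; [apply: Or31 | apply: Or33 | apply: Or32].
have done1 : (z ^+ k' = 1)%R -> k = k' %[mod p] \/ p %| k + k'.
  move/eqP; rewrite -(prim_order_dvd zp) => pk'; move: k'p p_gt1.
  by rewrite /coprime (gcdn_idPr pk') => /eqP ->.
have done2 : (z ^+ k' = z ^+ k)%R -> k = k' %[mod p] \/ p %| k + k'.
  by move/eqP; rewrite (eq_prim_root_expr zp) => /eqP ->; left.
have done3 : (z ^+ k' = z ^- k)%R -> k = k' %[mod p] \/ p %| k + k'.
  move=> E; right; rewrite (prim_order_dvd zp) exprD E mulfV //.
have cases w : (w = 1 \/ w = -1)%R -> forall u : algC,
    [\/ u = 1, u = z ^+ k | u = z ^- k]%R ->
    ((z ^- k') ^ w = u)%R -> k = k' %[mod p] \/ p %| k + k'.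
  move=> [->|->] u hu; rewrite ?expr1z -?[(_ ^ (-1))%R]/(_^-1)%R ?invrK => E.
    have {}E : (z ^+ k' = u^-1)%R by rewrite -E invrK.
    by case: hu => hu; rewrite hu ?invr1 ?invrK in E; auto.
  by case: hu => hu; rewrite hu in E; auto.
rewrite mulr1 => -[E|E]; first exact: cases hl _ rho_j E.
have {}E : ((z ^- k') ^ exp_cc M' c = (rho j)^-1)%R.
  have r0 : rho j != 0%R by apply: contra_eq_neq E => ->; rewrite mul0r oner_eq0.
  by apply: (mulfI r0); rewrite -E divff.
apply: cases hl _ _ E.
by case: rho_j => ->; rewrite ?invr1 ?invrK; [apply: Or31|apply: Or33|apply: Or32].
Qed.

End Rigidity.

(** * The groups G_{p,q} *)
Lemma exists_residue p (q : int) : 1 < p -> coprimez p%:Z q ->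
  exists k : nat, [/\ 0 < k, k < p, coprime k p & (k%:Z = - q %[mod p%:Z])%Z].
Proof.
move=> p_gt1 pq; have p0 : (p%:Z != 0)%R by rewrite eqz_nat; lia.
have Ek : Posz (absz ((- q)%R %% p%:Z)%Z) = ((- q)%R %% p%:Z)%Z.
  by rewrite gez0_abs // modz_ge0.
set k := absz _ in Ek.
have kq : (k%:Z = - q %[mod p%:Z])%Z by rewrite Ek modz_mod.
have kp : coprime k p.
  rewrite -[coprime k p]/(coprimez k%:Z p%:Z) coprimez_sym /coprimez.
  by rewrite -gcdz_modr Ek modz_mod gcdz_modr gcdzN.
exists k; split=> //.
  by case: (posnP k) kp => // ->; rewrite /coprime gcd0n => /eqP p1; move: p_gt1; rewrite p1.
by have := ltz_mod (- q)%R p0; rewrite -Ek; lia.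
Qed.
(*CUT2*)
Theorem mainTheorem1 (p : nat) (q r : int) (hp : (2 <= p)%N)
    (hq : coprimez (Posz p) q) (hr : coprimez (Posz p) r) :
  [/\ profinite_iso (G_ p q) (G_ p r),
      (exists phi : zaction (F_ (2 * p)%N),
         group_iso (G_ p q) (sdprodZ phi)) /\
      free_by_cyclic (G_ p q)
    & group_iso (G_ p q) (G_ p r) <->
      (q = r %[mod (Posz p)])%Z \/ (q = (- r)%R %[mod (Posz p)])%Z].
Proof.
have [k [k_gt0 k_ltp kp Ek]] := exists_residue hp hq.
have [k' [_ _ k'p Ek']] := exists_residue hp hr.
have M := G_marking hq Ek; have M' := G_marking hr Ek'.
have fib := marking_fibration hp k_gt0 k_ltp M.
split; first exact: marking_profinite_iso hp kp k'p M M'.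
  by split=> //; have [phi] := fib; exists (2 * p)%N, phi.
split=> [[f [f' fK f'K] fM]|[qr|qr]].
- have := marking_rigid hp M M' fM fK f'K k'p.
  move: Ek Ek' => /eqP + /eqP; rewrite !eqz_mod_dvd => Ek Ek' [kk'|kk'].
    have : (p%:Z %| (k%:Z - k'%:Z)%R)%Z.
      by rewrite -eqz_mod_dvd; apply/eqP; rewrite !modz_nat kk'.
    move=> d; left; apply/eqP; rewrite eqz_mod_dvd.
    have -> : (q - r = (k%:Z - - q) - (k'%:Z - - r) - (k%:Z - k'%:Z))%R by ring.
    by apply: rpredB => //; apply: rpredB.
  right; apply/eqP; rewrite eqz_mod_dvd.
  have -> : (q - - r = (k%:Z - - q) + (k'%:Z - - r) - (k + k')%:Z)%R.
    by rewrite PoszD; ring.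
  by apply: rpredB => //; apply: rpredD.
- apply: (marking_iso M); apply: G_marking hr _.
  move: Ek qr => /eqP + /eqP; rewrite !eqz_mod_dvd => d1 d2.
  apply/eqP; rewrite eqz_mod_dvd.
  have -> : (k%:Z - - r = (k%:Z - - q) - (q - r))%R by ring.
  exact: rpredB.
- apply: (marking_iso M); apply: marking_inv M'.
  move: Ek Ek' qr => /eqP + /eqP + /eqP; rewrite !eqz_mod_dvd => d1 d2 d3.
  rewrite -[p %| _]/(p%:Z %| (k' + k)%:Z)%Z.
  have -> : ((k' + k)%:Z = (k%:Z - - q) + (k'%:Z - - r) - (q - - r))%R.
    by rewrite PoszD; ring.
  by apply: rpredB => //; apply: rpredD.
Qed.
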